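(* The $B_n$-Courant algebroid over $M$ acts on $T^*M\oplus(M\times\mathbb{R})$ by special complex structures on $M$. That is: for every special complex structure $(J,\nabla)$ on $M$, the pair $(\mathrm{pr},\varrho)$, where $\mathrm{pr}:T^*M\oplus(M\times\mathbb{R})\to M$ is the projection and $\varrho(X+\alpha+f)=X^{h}$, is a Courant algebroid action of the $B_n$-Courant algebroid on the total space of $T^*M\oplus(M\times\mathbb{R})$.
   Context: Everything is smooth. A special complex structure on $M$ is a pair $(J,\nabla)$ of an almost complex structure $J$ on $M$ and a torsion-free affine connection $\nabla$ on $M$ such that $\nabla$ is flat and $d^\nabla J=0$, where $(d^\nabla J)(X,Y)=\nabla_X(JY)-\nabla_Y(JX)-J[X,Y]_{\mathrm{Lie}}$. The $B_n$-Courant algebroid is the bundle $\mathbb{E}=TM\oplus T^*M\oplus(M\times\mathbb{R})$ with pairing $\langle X+\alpha+f,Y+\beta+g\rangle=\alpha(Y)+\beta(X)+fg$, anchor $\rho=\mathrm{pr}_{TM}$, and bracket $$[X+\alpha+f,Y+\beta+g]=[X,Y]_{\mathrm{Lie}}+(L_X\beta-\iota_Yd\alpha+g\,df)+(Xg-Yf).$$ On $E=T^*M\oplus(M\times\mathbb{R})$ consider the vector bundle connection $\nabla^{J}_X(\alpha+f):=\nabla_X\alpha+Xf+\alpha(JX)$, with $\nabla_X\alpha$ the dual connection; the first summand lies in $T^*M$, the sum of the last two in $M\times\mathbb{R}$. For $X\in\mathfrak{X}(M)$, $X^h\in\mathfrak{X}(E)$ is the horizontal lift with respect to $\nabla^J$.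 A Courant algebroid action of a Courant algebroid $(\mathbb{E},\langle\,,\rangle,\rho,[\,,])$ over $M$ on a manifold $M'$ is a pair $(\Phi,\varrho)$ of a smooth map $\Phi:M'\to M$ and an $\mathbb{R}$-linear map $\varrho:\Gamma(\mathbb{E})\to\mathfrak{X}(M')$ such that for all $a,b\in\Gamma(\mathbb{E})$, $f\in C^\infty(M)$, $q\in M'$: $\Phi_{*q}(\varrho(a)_q)=\rho(a)_{\Phi(q)}$, $\varrho(fa)=(\Phi^*f)\varrho(a)$, and $[\varrho(a),\varrho(b)]_{\mathrm{Lie}}=\varrho([a,b])$. *)

(* Defs.v *)
From HB Require Import structures.
From mathcomp Require Import all_boot all_order all_algebra.
From mathcomp Require Import all_classical all_reals all_analysis.
Set Implicit Arguments.
Unset Strict Implicit.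
Unset Printing Implicit Defensive.
Import Order.TTheory GRing.Theory Num.Theory numFieldNormedType.Exports.
Local Open Scope classical_set_scope.
Local Open Scope ring_scope.

Section SmoothMaps.
Context {R : realType} {V W : normedModType R}.

(* Meant for open U, as the derivatives are taken in V. *)
Fixpoint Ck_on (k : nat) (U : set V) (f : V -> W) : Prop :=
  if k is k'.+1 then
    (forall x, U x -> differentiable f x) /\ (forall v, Ck_on k' U ('D_v f))
  else forall x, U x -> {for x, continuous f}.

Definition smooth_on (U : set V) (f : V -> W) : Prop := forall k, Ck_on k U f.

Lemma differentiable_eq_on (U : set V) (f g : V -> W) x :
  open U -> U x -> {in U, f =1 g} -> differentiable f x -> differentiable g x.
Proof.
move=> oU Ux fg df.
have fgx : f x = g x by apply: fg; rewrite inE.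
have nU : \forall y \near (0 : V), f (y + x) = g (y + x).
  have : \forall y \near x, f y = g y.
    by apply: filterS (open_nbhs_nbhs (conj oU Ux)) => y Uy; apply: fg; rewrite inE.
  rewrite (near_shift 0 x) => H.
  by apply: filterS H => y /=; rewrite subr0.
have dfc := diff_continuous df.
have E : g \o shift x = cst (g x) + 'd f x +o_ 0 id.
  apply/eqaddoP => e e0.
  have /eqaddoP/(_ e e0) H := diff_locally df.
  near=> y; rewrite -fgx.
  rewrite (_ : (g \o shift x - (cst (f x) + 'd f x)) y =
               (f \o shift x - (cst (f x) + 'd f x)) y); first by near: y.
  by rewrite !fctE /=; congr (_ - _); apply/esym; near: y.
apply/diff_locallyP.
have -> : 'd g x = 'd f x :> (V -> W) by apply: diff_unique.
by [].
Unshelve. all: by end_near. Qed.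

Lemma derive_eq_on (U : set V) (f g : V -> W) v :
  open U -> {in U, f =1 g} -> {in U, 'D_v f =1 'D_v g}.
Proof.
move=> oU fg x; rewrite inE => Ux; apply: near_eq_derive.
by apply: filterS (open_nbhs_nbhs (conj oU Ux)) => y Uy; apply: fg; rewrite inE.
Qed.

Lemma Ck_on_eq k (U : set V) (f g : V -> W) :
  open U -> {in U, f =1 g} -> Ck_on k U f -> Ck_on k U g.
Proof.
move=> oU; elim: k f g => [|k IH] f g fg /=.
  move=> cf x Ux; have : f @ x --> g x by rewrite -(fg x) ?inE//; exact: cf.
  rewrite /prop_for /continuous_at; apply: cvg_trans; apply: near_eq_cvg.
  by apply: filterS (open_nbhs_nbhs (conj oU Ux)) => y Uy; rewrite ?(fg y) ?inE.
move=> [df Df]; split=> [x Ux|v].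
  exact: (differentiable_eq_on oU Ux fg (df x Ux)).
apply: IH (Df v); exact: derive_eq_on.
Qed.

Lemma Ck_on_sub k (U U' : set V) (f : V -> W) :
  U' `<=` U -> Ck_on k U f -> Ck_on k U' f.
Proof.
move=> sU; elim: k f => [|k IH] f /=; first by move=> cf x /sU; exact: cf.
by move=> [df Df]; split=> [x /sU|v]; [exact: df|exact: IH].
Qed.

Lemma Ck_onW k (U : set V) (f : V -> W) : Ck_on k.+1 U f -> Ck_on k U f.
Proof.
elim: k f => [|k IH] f.
  by move=> [df _] x Ux; exact: differentiable_continuous (df x Ux).
by move=> [df Df]; split=> // v; exact: (IH _) (Df v).
Qed.

Lemma Ck_on_cst k (U : set V) (a : W) : Ck_on k U (cst a).
Proof.
elim: k a => [|k IH] a /=; first by move=> x _; exact: cst_continuous.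
split=> [x _|v]; first exact: differentiable_cst.
rewrite (_ : 'D_v (cst a) = cst 0) //.
by apply/funext => x; rewrite derive_cst.
Qed.

Lemma Ck_onD k (U : set V) (f g : V -> W) : open U ->
  Ck_on k U f -> Ck_on k U g -> Ck_on k U (f + g).
Proof.
move=> oU; elim: k f g => [|k IH] f g /=.
  by move=> cf cg x Ux; apply: continuousD; [exact: cf|exact: cg].
move=> [df Df] [dg Dg]; split=> [x Ux|v].
  by apply: differentiableD; [exact: df|exact: dg].
apply: (Ck_on_eq oU) (IH _ _ (Df v) (Dg v)) => x; rewrite inE => Ux.
by rewrite deriveD //; apply: diff_derivable; [exact: df|exact: dg].
Qed.

Lemma Ck_on_linear k (U : set V) (f : {linear V -> W}) :
  continuous f -> Ck_on k U f.
Proof.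
move=> cf; case: k => [|k] /=; first by move=> x _; exact: cf.
split=> [x _|v]; first exact: linear_differentiable.
rewrite (_ : 'D_v f = cst (f v)); first exact: Ck_on_cst.
by apply/funext => x; rewrite deriveE ?diff_lin//; exact: linear_differentiable.
Qed.

End SmoothMaps.

Section SmoothAlg.
Context {R : realType} {V : normedModType R}.

Lemma Ck_onM k (U : set V) (f g : V -> R) : open U ->
  Ck_on k U f -> Ck_on k U g -> Ck_on k U (fun x => f x * g x).
Proof.
move=> oU; elim: k f g => [|k IH] f g /=.
  by move=> cf cg x Ux; apply: continuousM; [exact: cf|exact: cg].
move=> [df Df] [dg Dg]; split=> [x Ux|v].
  by apply: differentiableM; [exact: df|exact: dg].
have cf : Ck_on k U f by exact: Ck_onW (conj df Df).
have cg : Ck_on k U g by exact: Ck_onW (conj dg Dg).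
apply: (Ck_on_eq oU) (Ck_onD oU (IH _ _ cf (Dg v)) (IH _ _ cg (Df v))) => x.
rewrite inE => Ux; apply/esym.
by apply: deriveM; apply: diff_derivable; [exact: df|exact: dg].
Qed.

Lemma Ck_on_sum k (U : set V) m (f : 'I_m -> V -> R) : open U ->
  (forall i, Ck_on k U (f i)) -> Ck_on k U (fun x => \sum_i f i x).
Proof.
move=> oU cf; rewrite (_ : (fun x => _) = \sum_i f i); last first.
  by apply/funext => x; rewrite fct_sumE.
elim/big_ind : _ => [|g h cg ch|i _]; [exact: Ck_on_cst|exact: Ck_onD|exact: cf].
Qed.

Lemma Ck_on_coord k (U : set V) m (f : V -> 'rV[R]_m) j : open U ->
  Ck_on k U f -> Ck_on k U (fun x => f x 0 j).
Proof.
move=> oU; elim: k f => [|k IH] f /=.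
  move=> cf x Ux; apply: (@continuous_comp _ _ _ f (fun M : 'rV[R]_m => M 0 j)).
    exact: cf.
  exact: coord_continuous.
move=> [df Df]; split=> [x Ux|v].
  apply: (@differentiable_comp _ _ _ _ f (fun M : 'rV[R]_m => M 0 j)).
    exact: df.
  exact: differentiable_coord.
apply: (Ck_on_eq oU) (IH _ (Df v)) => x; rewrite inE => Ux.
by rewrite derive_mx ?mxE//; exact: diff_derivable (df x Ux).
Qed.

Lemma Ck_on_row k (U : set V) m (f : V -> 'rV[R]_m) : open U ->
  (forall j, Ck_on k U (fun x => f x 0 j)) -> Ck_on k U f.
Proof.
move=> oU cf.
have lk j : continuous (fun a : R => a *: (delta_mx 0 j : 'rV[R]_m)).
  by move=> a; apply: continuousZl; exact: cvg_id.
have cS l (g : V -> R) j : Ck_on l U g ->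
    Ck_on l U (fun x => g x *: (delta_mx 0 j : 'rV[R]_m)).
  elim: l g => [|l IH] g /=.
    by move=> cg x Ux; apply: continuousZl; exact: cg.
  move=> [dg Dg]; split=> [x Ux|v].
    by apply: differentiableZl; exact: dg.
  apply: (Ck_on_eq oU) (IH _ (Dg v)) => x; rewrite inE => Ux.
  rewrite [RHS]deriveE; last by apply: differentiableZl; exact: dg.
  by rewrite diffZl ?deriveE//; exact: dg.
rewrite (_ : f = \sum_j (fun x => f x 0 j *: (delta_mx 0 j : 'rV[R]_m))).
  elim/big_ind : _ => [|g h cg ch|i _];
    [exact: Ck_on_cst|exact: Ck_onD|exact/cS/cf].
by apply/funext => x; rewrite fct_sumE [LHS]row_sum_delta.
Qed.

End SmoothAlg.

Section SmoothComp.
Context {R : realType} {V : normedModType R}.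

Lemma Ck_on_comp_R k m (U : set V) (A : set 'rV[R]_m)
    (f : V -> 'rV[R]_m) (g : 'rV[R]_m -> R) :
  open U -> open A -> (forall x, U x -> A (f x)) ->
  Ck_on k U f -> Ck_on k A g -> Ck_on k U (g \o f).
Proof.
move=> oU oA fA; elim: k g => [|k IH] g.
  move=> /= cf cg x Ux; apply: continuous_comp; first exact: cf.
  exact/cg/fA.
move=> cf cg; have cf' := Ck_onW cf; case: cf => df Df; case: cg => dg Dg.
split=> [x Ux|v].
  by apply: differentiable_comp; [exact: df|exact/dg/fA].
apply: (@Ck_on_eq _ _ _ _ _
  (fun x => \sum_j (('D_v f) x 0 j * ('D_(delta_mx 0 j) g \o f) x))) => //.
  move=> x; rewrite inE => Ux.
  have dfx := df x Ux; have dgx := dg _ (fA x Ux).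
  rewrite [RHS]deriveE; last exact: differentiable_comp.
  rewrite diff_comp // /= -[X in _ = _ X]deriveE //.
  set u := 'D_v f x; have -> : 'd g (f x) u = \sum_j u 0 j * 'd g (f x) 'e_j.
    rewrite {1}(row_sum_delta u) linear_sum.
    by apply: eq_bigr => j _; rewrite linearZ.
  by apply: eq_bigr => j _; rewrite /= deriveE.
apply: Ck_on_sum => // j; apply: Ck_onM => //; first by have := Ck_on_coord j oU (Df v).
by have := IH _ cf' (Dg 'e_j).
Qed.

Lemma Ck_on_comp k m l (U : set V) (A : set 'rV[R]_m)
    (f : V -> 'rV[R]_m) (g : 'rV[R]_m -> 'rV[R]_l) :
  open U -> open A -> (forall x, U x -> A (f x)) ->
  Ck_on k U f -> Ck_on k A g -> Ck_on k U (g \o f).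
Proof.
move=> oU oA fA cf cg; apply: Ck_on_row => // j.
by have := Ck_on_comp_R oU oA fA cf (Ck_on_coord j oA cg).
Qed.

Lemma jacobian_derive m (f : 'rV[R]_m -> 'rV[R]_m) x i j :
  differentiable f x -> ('J f x) i j = 'D_(delta_mx 0 i) f x 0 j.
Proof. by move=> df; rewrite deriveE // mxE. Qed.

Lemma derive_comp (V1 V2 V3 : normedModType R) (f : V1 -> V2) (g : V2 -> V3)
    v x y : f x = y -> differentiable f x -> differentiable g y ->
  'D_('D_v f x) g y = 'D_v (g \o f) x.
Proof.
move=> <- df dg; rewrite [RHS]deriveE; last exact: differentiable_comp.
by rewrite diff_comp // deriveE // deriveE.
Qed.

End SmoothComp.

Definition atlas_open (R : realType) (n : nat) (M I : Type) (mdom : I -> set M)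
    (mcoord : I -> M -> 'rV[R]_n) (A : set M) : Prop :=
  forall i, open (mcoord i @` (mdom i `&` A)).

(* A smooth n-manifold is a set with an atlas, whose topology is the one for which
   the charts are homeomorphisms onto open subsets of R^n; it is Hausdorff and
   covered by countably many charts, which amounts (chart images being open in R^n)
   to second countability. The inverse of the chart i is mparam i, with junk values
   outside of mcoord i @` mdom i.
   Every point p has a preferred chart mchart_at p, and T_p M is identified with
   'rV[R]_n by means of it: the row vector v stands for the tangent vector with
   components v in the chart mchart_at p. Likewise T_p^* M is identified with
   'rV[R]_n by the dual basis, a covector a being evaluated on v as a *m v^T. *)
Record manifold (R : realType) (n : nat) := Manifold {
  mpoint :> Type ;
  mchart : Type ;
  mdom : mchart -> set mpoint ;
  mcoord : mchart -> mpoint -> 'rV[R]_n ;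
  mparam : mchart -> 'rV[R]_n -> mpoint ;
  mchart_at : mpoint -> mchart ;
  mchart_atP : forall p, mdom (mchart_at p) p ;
  mcoordK : forall i p, mdom i p -> mparam i (mcoord i p) = p ;
  overlap_open : forall i j, open (mcoord i @` (mdom i `&` mdom j)) ;
  transition_smooth : forall i j,
    smooth_on (mcoord i @` (mdom i `&` mdom j)) (mcoord j \o mparam i) ;
  charts_countable : exists S : set mchart,
    countable S /\ forall p, exists2 i, S i & mdom i p ;
  charts_hausdorff : forall p q : mpoint, p <> q -> exists A B : set mpoint,
    [/\ atlas_open mdom mcoord A, atlas_open mdom mcoord B, A p, B q &
        A `&` B = set0]
}.

Arguments mcoordK {R n} m i p.
Arguments overlap_open {R n} m i j.
Arguments transition_smooth {R n} m i j.

Section Charts.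
Context {R : realType} {n : nat} (M : manifold R n).
Implicit Types (p : M) (i j k : mchart M).

Definition mopen : set (set M) := atlas_open (@mdom _ _ M) (@mcoord _ _ M).

(* The matrix of d(x_j^l)/d(x_i^k) at p: v *m jac i j p are the components in the
   chart j of the vector with components v in the chart i, and a *m (jac i j p)^T
   the components in the chart i of the covector with components a in j. *)
Definition jac i j p : 'M[R]_n := 'J (mcoord j \o mparam i) (mcoord i p).

Lemma transitionE i j x :
  (mcoord i @` (mdom i `&` mdom j)) x ->
  (mcoord j @` (mdom j `&` mdom i)) ((mcoord j \o mparam i) x).
Proof. by move=> [p [ip jp] <-] /=; rewrite mcoordK//; exists p. Qed.

Lemma differentiable_transition i j p : mdom i p -> mdom j p ->
  differentiable (mcoord j \o mparam i) (mcoord i p).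
Proof.
move=> ip jp; have [+ _] := transition_smooth M i j 1%N.
by apply; exists p.
Qed.

Lemma jac_id i p : mdom i p -> jac i i p = 1%:M.
Proof.
move=> ip; apply/row_matrixP => l; rewrite !rowE mulmx1.
rewrite /jac -deriveEjacobian; last exact: differentiable_transition.
have := @derive_eq_on R _ _ _ id (mcoord i \o mparam i) 'e_l (overlap_open M i i).
move=> <-; first exact: derive_id; last by rewrite inE; exists p.
by move=> x; rewrite inE => -[q [iq _] <-] /=; rewrite mcoordK.
Qed.

Lemma jac_comp i j k p : mdom i p -> mdom j p -> mdom k p ->
  jac i j p *m jac j k p = jac i k p.
Proof.
move=> ip jp kp; apply/row_matrixP => l; rewrite !rowE mulmxA /jac.
have dij := differentiable_transition ip jp.
have djk := differentiable_transition jp kp.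
have dik := differentiable_transition ip kp.
pose D := 'D_'e_l (mcoord j \o mparam i) (mcoord i p).
suff K : 'D_D (mcoord k \o mparam j) (mcoord j p) =
         'D_'e_l (mcoord k \o mparam i) (mcoord i p).
  exact: (etrans (congr1 (fun u => u *m _) (esym (deriveEjacobian 'e_l dij)))
    (etrans (esym (deriveEjacobian D djk)) (etrans K (deriveEjacobian 'e_l dik)))).
have pE : (mcoord j \o mparam i) (mcoord i p) = mcoord j p by rewrite /= mcoordK.
pose U := mcoord i @` (mdom i `&` mdom j).
have := @derive_eq_on R _ _ U ((mcoord k \o mparam j) \o (mcoord j \o mparam i))
  (mcoord k \o mparam i) 'e_l (overlap_open M i j).
move=> <-; last by rewrite inE; exists p.
  exact: derive_comp pE dij djk.
by move=> x; rewrite inE => -[q [iq jq] <-] /=; rewrite !mcoordK.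
Qed.

End Charts.
Arguments jac {R n M}.

Section Bundle.
Context {R : realType} {n : nat} (M : manifold R n).

(* The total space of T^*M + (M x R), with the charts
   (p, xi_k dx_i^k, t) |-> (x_i(p), xi, t) for i a chart of M. *)
Definition bpoint : Type := (M * ('rV[R]_n * R^o))%type.
Implicit Types (e : bpoint) (y : 'rV[R]_(n + (n + 1))) (i j : mchart M).

Definition bdom i : set bpoint := [set e | mdom i e.1].
Definition bcoord i e : 'rV[R]_(n + (n + 1)) :=
  row_mx (mcoord i e.1)
    (row_mx (e.2.1 *m (jac i (mchart_at e.1) e.1)^T) (const_mx e.2.2)).
Definition bparam i y : bpoint :=
  let p := mparam i (lsubmx y) in
  (p, (lsubmx (rsubmx y) *m (jac (mchart_at p) i p)^T, rsubmx (rsubmx y) 0 0)).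
Definition bchart_at e : mchart M := mchart_at e.1.

Lemma bchart_atP e : bdom (bchart_at e) e.
Proof. exact: mchart_atP. Qed.

Lemma bcoordK i e : bdom i e -> bparam i (bcoord i e) = e.
Proof.
case: e => p [a t]; rewrite /bdom /= => ip.
rewrite /bparam /bcoord /= row_mxKl row_mxKr row_mxKl row_mxKr mcoordK //.
rewrite mxE -mulmxA -trmx_mul jac_comp //; try exact: mchart_atP.
by rewrite jac_id ?trmx1 ?mulmx1 //; exact: mchart_atP.
Qed.

Lemma bcoord_param i y p : mdom i p -> mcoord i p = lsubmx y ->
  bcoord i (bparam i y) = y.
Proof.
move=> ip E; rewrite /bcoord /bparam /= -E mcoordK // E.
rewrite -mulmxA -trmx_mul jac_comp //; try exact: mchart_atP.
rewrite jac_id // trmx1 mulmx1 [X in row_mx (lsubmx (rsubmx y)) X](_ : _ = rsubmx (rsubmx y)).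
  by rewrite !hsubmxK.
by apply/rowP => k; rewrite mxE ord1.
Qed.

Lemma bcoord_image i (S : set M) :
  bcoord i @` (bdom i `&` fst @^-1` S) = lsubmx @^-1` (mcoord i @` (mdom i `&` S)).
Proof.
apply/seteqP; split => y /=.
  by move=> [e [ie Se] <-]; exists e.1 => //; rewrite row_mxKl.
move=> [p [ip Sp] E]; exists (bparam i y); last exact: bcoord_param E.
by split; rewrite /bdom /= -E mcoordK.
Qed.

Lemma open_lsubmx m1 m2 (A : set 'rV[R]_m1) :
  open A -> open (lsubmx @^-1` A : set 'rV[R]_(m1 + m2)).
Proof. by move=> oA; apply: open_comp => // y _; exact: continuous_lsubmx. Qed.

Lemma boverlap i j : bcoord i @` (bdom i `&` bdom j) =
  lsubmx @^-1` (mcoord i @` (mdom i `&` mdom j)).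
Proof. exact: (bcoord_image i (mdom j)). Qed.

Lemma boverlap_open i j : open (bcoord i @` (bdom i `&` bdom j)).
Proof. by rewrite boverlap; apply/open_lsubmx/overlap_open. Qed.

Lemma btransition_smooth i j :
  smooth_on (bcoord i @` (bdom i `&` bdom j)) (bcoord j \o bparam i).
Proof.
move=> k; have oO := @boverlap_open i j; set O := (X in Ck_on k X _).
have OE : O = lsubmx @^-1` (mcoord i @` (mdom i `&` mdom j)) := boverlap i j.
have lC : Ck_on k O (lsubmx : 'rV[R]_(n + (n + 1)) -> 'rV_n).
  by apply: Ck_on_linear; exact: continuous_lsubmx.
have rC : Ck_on k O (rsubmx : 'rV[R]_(n + (n + 1)) -> 'rV_(n + 1)).
  by apply: Ck_on_linear; exact: continuous_rsubmx.
have lO y : O y -> (mcoord i @` (mdom i `&` mdom j)) (lsubmx y) by rewrite OE.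
have tC : Ck_on k O ((mcoord j \o mparam i) \o lsubmx).
  exact: Ck_on_comp oO (overlap_open M i j) lO lC (transition_smooth M i j k).
have tO y : O y ->
    (mcoord j @` (mdom j `&` mdom i)) (((mcoord j \o mparam i) \o lsubmx) y).
  by move=> /lO; exact: transitionE.
have jC l m : Ck_on k O
    (fun y => (jac j i (mparam i (lsubmx y))) l m).
  apply: (@Ck_on_eq _ _ _ _ _ ((fun x => ('D_'e_l (mcoord i \o mparam j)) x 0 m) \o
                        ((mcoord j \o mparam i) \o lsubmx))) => //.
    move=> y; rewrite inE => Oy; rewrite /jac /= jacobian_derive //.
    have [p [ip jp] <-] := lO y Oy; rewrite mcoordK //.
    exact: differentiable_transition.
  have [_ /(_ 'e_l) tD] := transition_smooth M j i k.+1.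
  have oj := overlap_open M j i.
  exact: Ck_on_comp_R oO oj tO tC (Ck_on_coord m oj tD).
have xC m : Ck_on k O (fun y => lsubmx (rsubmx y) 0 m).
  apply: Ck_on_coord => //.
  have lT : Ck_on k setT (lsubmx : 'rV[R]_(n + 1) -> 'rV_n).
    by apply: Ck_on_linear; exact: continuous_lsubmx.
  exact: Ck_on_comp oO openT (fun _ _ => I) rC lT.
have sC : Ck_on k O (fun y => rsubmx (rsubmx y) 0 0).
  apply: Ck_on_coord => //.
  have rT : Ck_on k setT (rsubmx : 'rV[R]_(n + 1) -> 'rV_1).
    by apply: Ck_on_linear; exact: continuous_rsubmx.
  exact: Ck_on_comp oO openT (fun _ _ => I) rC rT.
apply: (@Ck_on_eq _ _ _ _ O (fun y => row_mx ((mcoord j \o mparam i) (lsubmx y))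
   (row_mx (lsubmx (rsubmx y) *m
             (jac j i (mparam i (lsubmx y)))^T)
           (const_mx (rsubmx (rsubmx y) 0 0)))) _ oO).
  move=> y; rewrite inE => /lO [p [ip jp] E].
  rewrite /bcoord /bparam; cbn; rewrite -E !(mcoordK _ _ _ ip) -mulmxA -trmx_mul.
  by rewrite (jac_comp jp (mchart_atP p) ip).
apply: Ck_on_row => // l; case: (splitP l) => [l1 | l2] El.
  apply: (@Ck_on_eq _ _ _ _ _ (fun y => ((mcoord j \o mparam i) \o lsubmx) y 0 l1)) => //.
    by move=> y _; rewrite (_ : l = lshift _ l1) ?row_mxEl//; exact: val_inj.
  exact: Ck_on_coord.
case: (splitP l2) => [l3 | l4] El2.
  apply: (@Ck_on_eq _ _ _ _ _ (fun y => \sum_m lsubmx (rsubmx y) 0 m *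
     (jac j i (mparam i (lsubmx y))) l3 m)) => //.
    move=> y _; rewrite (_ : l = rshift _ (lshift _ l3)); last first.
      by apply: val_inj; rewrite /= El El2.
    rewrite row_mxEr row_mxEl mxE; apply: eq_bigr => m _.
    by congr (_ * _); rewrite [RHS]mxE.
  apply: Ck_on_sum => // m; exact: Ck_onM.
apply: (Ck_on_eq oO _ sC) => y _.
rewrite (_ : l = rshift _ (rshift _ l4)); last first.
  by apply: val_inj; rewrite /= El El2.
by rewrite !row_mxEr [in RHS]mxE.
Qed.

Lemma bcharts_countable : exists S : set (mchart M),
  countable S /\ forall e, exists2 i, S i & bdom i e.
Proof.
have [S [cS SP]] := charts_countable M.
by exists S; split => // e; have [i Si ie] := SP e.1; exists i.
Qed.

Lemma bcharts_hausdorff e e' : e <> e' -> exists A B : set bpoint,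
  [/\ atlas_open bdom bcoord A, atlas_open bdom bcoord B, A e, B e' &
      A `&` B = set0].
Proof.
move=> ne; case: (pselect (e.1 = e'.1)) => [E | ]; last first.
  move=> /charts_hausdorff [A [B [oA oB Ae Be AB]]].
  exists (fst @^-1` A), (fst @^-1` B); split => //; last first.
  - by rewrite -preimage_setI AB preimage_set0.
  - by move=> i; rewrite bcoord_image; exact/open_lsubmx/oB.
  - by move=> i; rewrite bcoord_image; exact/open_lsubmx/oA.
pose i := mchart_at e.1.
have ie : bdom i e by exact: mchart_atP.
have ie' : bdom i e' by rewrite /bdom /= -E; exact: mchart_atP.
have nx : bcoord i e != bcoord i e'.
  by apply/eqP => /(congr1 (bparam i)); rewrite !bcoordK.
have := @norm_hausdorff R 'rV[R]_(n + (n + 1)); rewrite open_hausdorff.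
move=> /(_ _ _ nx)[[W W']] /= [/set_mem Wx /set_mem Wx'] [oW oW' /eqP WW'].
have oP (V : set 'rV[R]_(n + (n + 1))) : open V ->
    atlas_open bdom bcoord (bdom i `&` bcoord i @^-1` V).
  move=> oV j.
  rewrite (_ : _ @` _ = (bcoord j @` (bdom j `&` bdom i)) `&`
                        (bcoord i \o bparam j) @^-1` V); last first.
    apply/seteqP; split => y /=.
      by move=> [z [jz [iz Vz]] <-]; split; [exists z|rewrite bcoordK].
    by move=> [[z [jz iz] <-]]; rewrite bcoordK // => Vz; exists z.
  rewrite openE => y [Oy Vy]; apply: filterI.
    exact: (open_nbhs_nbhs (conj (@boverlap_open j i) Oy)).
  have cy : {for y, continuous (bcoord i \o bparam j)}.
    exact: (@btransition_smooth j i 0%N).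
  exact: cy (open_nbhs_nbhs (conj oV Vy)).
exists (bdom i `&` bcoord i @^-1` W), (bdom i `&` bcoord i @^-1` W').
split; [exact: oP|exact: oP|by []|by []|].
apply/seteqP; split => // z /= [[_ Wz] [_ Wz']].
by have : (W `&` W') (bcoord i z) by []; rewrite WW'.
Qed.

Definition bundle : manifold R (n + (n + 1)) :=
  Manifold bchart_atP bcoordK boverlap_open btransition_smooth
    bcharts_countable bcharts_hausdorff.

End Bundle.

Section Calculus.
Context {R : realType} {n : nat} {M : manifold R n}.
Implicit Types (p : M) (X Y Z : M -> 'rV[R]_n) (a b : M -> 'rV[R]_n) (f : M -> R).

Definition smooth_fun f : Prop :=
  forall i : mchart M, smooth_on (mcoord i @` mdom i) (f \o mparam i).

(* Local representatives, in the chart i, of a field of vectors and of a field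
   of covectors. *)
Definition vec_in (i : mchart M) X (x : 'rV[R]_n) : 'rV[R]_n :=
  let p := mparam i x in X p *m jac (mchart_at p) i p.
Definition covec_in (i : mchart M) a (x : 'rV[R]_n) : 'rV[R]_n :=
  let p := mparam i x in a p *m (jac i (mchart_at p) p)^T.

Definition smooth_field X : Prop :=
  forall i : mchart M, smooth_on (mcoord i @` mdom i) (vec_in i X).
Definition smooth_form a : Prop :=
  forall i : mchart M, smooth_on (mcoord i @` mdom i) (covec_in i a).

(* a(X) *)
Definition ev a X p : R := (a p *m (X p)^T) 0 0.

(* X f *)
Definition deriv X f p : R :=
  'D_(X p) (f \o mparam (mchart_at p)) (mcoord (mchart_at p) p).

(* The coordinate formula [X, Y]^k = X^i d_i Y^k - Y^i d_i X^k, used at p in the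
   preferred chart of p. *)
Definition lie X Y p : 'rV[R]_n :=
  let c := mchart_at p in
  'D_(X p) (vec_in c Y) (mcoord c p) - 'D_(Y p) (vec_in c X) (mcoord c p).

Definition fscale (F : lmodType R) f (s : M -> F) : M -> F :=
  fun p => f p *: s p.

(* The 1-form Z |-> F Z, for F a C^oo(M)-linear map from vector fields to smooth
   functions (such a 1-form exists and is unique). *)
Definition form_of (F : (M -> 'rV[R]_n) -> M -> R) : M -> 'rV[R]_n :=
  xget 0 [set a | smooth_form a /\
                  forall Z, smooth_field Z -> forall p, ev a Z p = F Z p].

Definition dfun f := form_of (fun Z p => deriv Z f p).

Definition lie_form X b :=
  form_of (fun Z p => deriv X (ev b Z) p - ev b (lie X Z) p).

(* iota_Y (d a) *)
Definition int_d Y a :=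
  form_of (fun Z p =>
    deriv Y (ev a Z) p - deriv Z (ev a Y) p - ev a (lie Y Z) p).

End Calculus.

Section Maps.
Context {R : realType} {m n : nat} {M : manifold R m} {N : manifold R n}.

Definition smooth_map (phi : M -> N) : Prop :=
  (forall A : set N, mopen A -> mopen (phi @^-1` A)) /\
  forall (i : mchart M) (j : mchart N),
    smooth_on (mcoord i @` (mdom i `&` phi @^-1` mdom j)) (mcoord j \o phi \o mparam i).

(* phi_{*q} v *)
Definition pushforward (phi : M -> N) (q : M) (v : 'rV[R]_m) : 'rV[R]_n :=
  v *m 'J (mcoord (mchart_at (phi q)) \o phi \o mparam (mchart_at q))
          (mcoord (mchart_at q) q).

End Maps.

Section Connections.
Context {R : realType} {n : nat} {M : manifold R n}.
Implicit Types (X Y Z : M -> 'rV[R]_n) (J : M -> 'M[R]_n)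
  (nabla : (M -> 'rV[R]_n) -> (M -> 'rV[R]_n) -> M -> 'rV[R]_n).

(* J p acts on T_p M = 'rV_n on the right. *)
Definition endo J X : M -> 'rV[R]_n := fun p => X p *m J p.

Record almost_complex J : Prop := {
  ac_smooth : forall (i : mchart M) (v : 'rV[R]_n), smooth_on (mcoord i @` mdom i)
    (fun x => let p := mparam i x in
      v *m jac i (mchart_at p) p *m J p *m jac (mchart_at p) i p) ;
  ac_square : forall p, J p *m J p = - 1%:M }.

Record affine_connection nabla : Prop := {
  conn_smooth : forall X Y, smooth_field X -> smooth_field Y ->
    smooth_field (nabla X Y) ;
  conn_linl : forall (f : M -> R) X X' Y, smooth_fun f ->
    smooth_field X -> smooth_field X' -> smooth_field Y ->
    nabla (fscale f X + X') Y = fscale f (nabla X Y) + nabla X' Y ;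
  conn_linr : forall (c : R) X Y Y',
    smooth_field X -> smooth_field Y -> smooth_field Y' ->
    nabla X (c *: Y + Y') = c *: nabla X Y + nabla X Y' ;
  conn_leibniz : forall (f : M -> R) X Y, smooth_fun f ->
    smooth_field X -> smooth_field Y ->
    nabla X (fscale f Y) = fscale (deriv X f) Y + fscale f (nabla X Y) }.

Definition torsion_free nabla : Prop := forall X Y,
  smooth_field X -> smooth_field Y -> nabla X Y - nabla Y X = lie X Y.

Definition flat nabla : Prop := forall X Y Z,
  smooth_field X -> smooth_field Y -> smooth_field Z ->
  nabla X (nabla Y Z) - nabla Y (nabla X Z) - nabla (lie X Y) Z = 0.

Definition d_nabla nabla J X Y : M -> 'rV[R]_n :=
  nabla X (endo J Y) - nabla Y (endo J X) - endo J (lie X Y).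

Record special_complex_structure J nabla : Prop := {
  scs_complex : almost_complex J ;
  scs_connection : affine_connection nabla ;
  scs_torsion_free : torsion_free nabla ;
  scs_flat : flat nabla ;
  scs_closed : forall X Y, smooth_field X -> smooth_field Y ->
    d_nabla nabla J X Y = 0 }.

Definition dual_connection nabla X (a : M -> 'rV[R]_n) : M -> 'rV[R]_n :=
  form_of (fun Y p => deriv X (ev a Y) p - ev a (nabla X Y) p).

(* Sections of T^*M + (M x R), and the connection nabla^J on it. *)
Definition smooth_section (s : M -> 'rV[R]_n * R^o) : Prop :=
  smooth_form (fst \o s) /\ smooth_fun (snd \o s).

Definition nablaJ J nabla X (s : M -> 'rV[R]_n * R^o) : M -> 'rV[R]_n * R^o :=
  fun p => (dual_connection nabla X (fst \o s) p,
            deriv X (snd \o s) p + ev (fst \o s) (endo J X) p).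

End Connections.

Section HorizontalLift.
Context {R : realType} {n : nat} {M : manifold R n}.
Implicit Types (D : (M -> 'rV[R]_n) ->
                    (M -> 'rV[R]_n * R^o) -> M -> 'rV[R]_n * R^o).

Definition bundle_proj : bundle M -> M := fst.

Definition section_map (s : M -> 'rV[R]_n * R^o) : M -> bundle M :=
  fun p => (p, s p).

(* The horizontal subspace at e of a connection D: the tangent vectors s_{*p} v,
   for s a section through e whose covariant derivative vanishes at p = pr(e). *)
Definition horizontal D (e : bundle M) : set 'rV[R]_(n + (n + 1)) :=
  [set w | exists s v, let p := bundle_proj e in
    [/\ smooth_section s, section_map s p = e,
        forall Y, smooth_field Y -> D Y s p = 0 &
        w = pushforward (section_map s) p v]].

(* The unique horizontal vector over X, at every point of the total space. *)
Definition hlift D (X : M -> 'rV[R]_n) : bundle M -> 'rV[R]_(n + (n + 1)) :=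
  fun e => xget 0 [set w | horizontal D e w /\
                           pushforward bundle_proj e w = X (bundle_proj e)].

End HorizontalLift.

(* The data of a Courant algebroid over M on which the notion of action depends;
   as for TM, the fibers are identified with a fixed space, and a section is a
   map from M to it. *)
Record courant_data (R : realType) (n : nat) (M : manifold R n) := CourantData {
  ca_fiber : lmodType R ;
  ca_smooth : set (M -> ca_fiber) ;
  ca_pairing : M -> ca_fiber -> ca_fiber -> R ;
  ca_anchor : M -> ca_fiber -> 'rV[R]_n ;
  ca_bracket : (M -> ca_fiber) -> (M -> ca_fiber) -> M -> ca_fiber }.

Record courant_action (R : realType) (n m : nat) (M : manifold R n)
    (E : courant_data M) (M' : manifold R m) (phi : M' -> M)
    (rho : (M -> ca_fiber E) -> M' -> 'rV[R]_m) : Prop := {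
  act_smooth_map : smooth_map phi ;
  act_smooth : forall a, ca_smooth a -> smooth_field (rho a) ;
  act_linear : forall (c : R) a b, ca_smooth a -> ca_smooth b ->
    rho (c *: a + b) = c *: rho a + rho b ;
  act_anchor : forall a, ca_smooth a -> forall q,
    pushforward phi q (rho a q) = ca_anchor (phi q) (a (phi q)) ;
  act_scale : forall (f : M -> R) a, smooth_fun f -> ca_smooth a ->
    rho (fscale f a) = fscale (f \o phi) (rho a) ;
  act_bracket : forall a b, ca_smooth a -> ca_smooth b ->
    lie (rho a) (rho b) = rho (ca_bracket a b) }.

Section BnCourant.
Context {R : realType} {n : nat} (M : manifold R n).

(* Sections X + alpha + f of TM + T^*M + (M x R). *)
Let Bn_fiber : lmodType R := ('rV[R]_n * ('rV[R]_n * R^o))%type.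
Implicit Types (s t : M -> Bn_fiber).

Definition vec_part s : M -> 'rV[R]_n := fun p => (s p).1.
Definition form_part s : M -> 'rV[R]_n := fun p => (s p).2.1.
Definition fun_part s : M -> R := fun p => (s p).2.2.

Definition Bn_smooth : set (M -> Bn_fiber) :=
  [set s | [/\ smooth_field (vec_part s), smooth_form (form_part s) &
               smooth_fun (fun_part s)]].

Definition Bn_pairing (p : M) (u v : Bn_fiber) : R :=
  (u.2.1 *m v.1^T) 0 0 + (v.2.1 *m u.1^T) 0 0 + u.2.2 * v.2.2.

Definition Bn_anchor (p : M) (u : Bn_fiber) : 'rV[R]_n := u.1.

Definition Bn_bracket s t : M -> Bn_fiber :=
  let X := vec_part s in let Y := vec_part t in
  let a := form_part s in let b := form_part t in
  let f := fun_part s in let g := fun_part t in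
  fun p => (lie X Y p,
            (lie_form X b p - int_d Y a p + g p *: dfun f p,
             deriv X g p - deriv Y f p)).

Definition Bn_courant : courant_data M :=
  CourantData Bn_smooth Bn_pairing Bn_anchor Bn_bracket.

End BnCourant.

(* Main.v *)
From mathcomp Require Import all_boot all_order all_algebra.
From mathcomp Require Import all_classical all_reals all_analysis.
From mathcomp Require Import ring lra.
Require Import Defs.
Set Implicit Arguments.
Unset Strict Implicit.
Unset Printing Implicit Defensive.
Import Order.TTheory GRing.Theory Num.Theory numFieldNormedType.Exports.
Local Open Scope classical_set_scope.
Local Open Scope ring_scope.

(** An action has to send X to the horizontal lift X^h of X, so the point is the
identity [X^h, Y^h] = [X, Y]^h. Vector fields on the total space of
E = T^*M + (M x R) are determined by their effect on a few functions: those
pulled back from M, the fibre coordinate t, and, for every vector field Z on M,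
the function l_Z(xi, t) = xi(Z), linear on the fibres. A parallel section
(alpha, t) in the direction X satisfies X(alpha(Z)) = alpha(nabla_X Z) and
X t = - alpha(J X), which reads

  X^h l_Z = l_(nabla_X Z),   X^h t = - l_(J X),   X^h projects to X.

Hence [X^h, Y^h] l_Z = l_(nabla_X nabla_Y Z - nabla_Y nabla_X Z), which flatness
turns into l_(nabla_[X, Y] Z) = [X, Y]^h l_Z; and [X^h, Y^h] t =
- l_(nabla_X (J Y) - nabla_Y (J X)), which d^nabla J = 0 turns into
- l_(J [X, Y]) = [X, Y]^h t. The remaining axioms come from the same three
identities, whose right-hand sides are C^oo(M)-linear in X.

In coordinates, for a frame E_l of vector fields with constant components near
the point considered, l_(E_l) is the l-th fibre coordinate, so X^h has
components (X, l_(nabla_X E_l), - l_(J X)): this is hlift_in_form. It exhibits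
X^h as smooth, and it spares the symmetry of second derivatives in hlift_lie:
the bracket in coordinates consists of the derivatives of the components of Y^h
along X^h and conversely, and hlift_in_ell provides these.

The connection only acts on globally defined fields, forms and sections are
global as well, and horizontal vectors are tangent to global sections. Passing
to coordinates therefore rests on smooth cutoffs: bump_exists produces them on
R^n from exp(-1/t), and smooth_on_glue extends functions with compact support in
a chart by zero, where the Hausdorff property enters. The resulting tool is
local_frame: around every point there are global fields E_l with components
constant near it, and an F that is additive and satisfies F(f Z) = f(p) F(Z) is
determined by the values F(E_l). Applied to the forms Z |-> X(a(Z)) - a(nabla_X
Z) it makes sense of the dual connection (form_of_spec), and applied to both
arguments of the connection it yields, through every point of E, a section whose
covariant derivative vanishes there (horizontal_section). *)

(** * Smoothness on open sets of normed spaces *)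

Section SmoothnessExtra.
Context {R : realType} {V : normedModType R}.

Lemma Ck_on_local (W : normedModType R) k (U : set V) (f : V -> W) :
  (forall x, U x -> exists P : set V, [/\ open P, P x & Ck_on k P f]) ->
  Ck_on k U f.
Proof.
elim: k f => [|k IH] f H /=.
  by move=> x /H[P [_ Ox]]; apply.
split=> [x /H[P [_ Ox [df _]]]|v]; first exact: df.
by apply: IH => x /H[P [oO Ox [_ Df]]]; exists P; split=> //; exact: Df.
Qed.

Lemma smooth_on_near (W : normedModType R) (U : set V) (f : V -> W) :
  (forall x, U x -> exists (P : set V) (g : V -> W),
    [/\ open P, P x, smooth_on P g & {in P, f =1 g}]) ->
  smooth_on U f.
Proof.
move=> H k; apply: Ck_on_local => x /H[P [g [oO Ox sg fg]]]; exists P; split => //.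
by apply: Ck_on_eq (sg k) => // y Oy; rewrite fg.
Qed.

Lemma smooth_on_differentiable (W : normedModType R) (U : set V) (f : V -> W) x :
  smooth_on U f -> U x -> differentiable f x.
Proof. by move=> /(_ 1%N)[df _]; exact: df. Qed.

Lemma Ck_onN (W : normedModType R) k (U : set V) (f : V -> W) : open U ->
  Ck_on k U f -> Ck_on k U (- f).
Proof.
move=> oU; elim: k f => [|k IH] f /=.
  by move=> cf x Ux; apply: continuousN; exact: cf.
move=> [df Df]; split=> [x Ux|v]; first by apply: differentiableN; exact: df.
apply: (Ck_on_eq oU) (IH _ (Df v)) => x; rewrite inE => Ux.
by rewrite deriveN //; apply: diff_derivable; exact: df.
Qed.

Lemma Ck_onV k (U : set V) (f : V -> R) : open U ->
  (forall x, U x -> f x != 0) ->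
  Ck_on k U f -> Ck_on k U (fun x => (f x)^-1).
Proof.
move=> oU f0; elim: k => [|k IH] /=.
  by move=> cf x Ux; apply: cvgV; [exact: f0|exact: cf].
move=> cf; have cfk : Ck_on k U f by exact: Ck_onW cf.
case: cf => df Df; split=> [x Ux|v].
  by apply: differentiableV; [exact: df|exact: f0].
have cV := IH cfk.
apply: (Ck_on_eq oU) (Ck_onN oU (Ck_onM oU (Ck_onM oU cV cV) (Df v))) => x.
rewrite inE => Ux; rewrite deriveV; last 2 first.
- exact: f0.
- by apply: diff_derivable; exact: df.
by rewrite [LHS]/=  expr2 invfM scaleNr.
Qed.

Lemma Ck_on_prod k (U : set V) m (f : 'I_m -> V -> R) : open U ->
  (forall i, Ck_on k U (f i)) -> Ck_on k U (fun x => \prod_i f i x).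
Proof.
move=> oU cf; elim: m f cf => [|m IH] f cf.
  rewrite (_ : (fun _ => _) = cst 1); first exact: Ck_on_cst.
  by apply/funext => x; rewrite big_ord0.
rewrite (_ : (fun _ => _) = fun x => f ord0 x * \prod_i f (lift ord0 i) x).
  by apply: Ck_onM => //; apply: IH => i; exact: cf.
by apply/funext => x; rewrite big_ord_recl.
Qed.

End SmoothnessExtra.

(** * Smooth bump functions *)

Section Flat.
Context {R : realType}.
Implicit Types t : R.

(** The functions t^-m exp(-1/t), extended by 0 to the negative axis. The family
over all m is closed under differentiation up to linear combinations, so that
smoothness of each member follows by one induction. *)
Definition flat_fun (m : nat) t : R :=
  if 0 < t then t^-1 ^+ m * expR (- t^-1) else 0.

Lemma flat_fun_ge0 m t : 0 <= flat_fun m t.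
Proof.
rewrite /flat_fun; case: ifPn => // t0.
by rewrite mulr_ge0 ?expR_ge0 // exprn_ge0 // invr_ge0 ltW.
Qed.

(** With u = 1/t this is u^(m + 1) <= (m + 1)^(m + 1) exp(u), the (m + 1)-st power
of u / (m + 1) <= exp(u / (m + 1)). *)
Lemma flat_fun_le m t : 0 < t -> flat_fun m t <= m.+1%:R ^+ m.+1 * t.
Proof.
move=> t0; rewrite /flat_fun t0; set u := t^-1.
have u0 : 0 < u by rewrite invr_gt0.
have m0 : (0 : R) < m.+1%:R by rewrite ltr0n.
have H : (u / m.+1%:R) ^+ m.+1 <= expR u.
  have -> : u = m.+1%:R * (u / m.+1%:R).
    by rewrite mulrC divfK // gt_eqF.
  rewrite expRM_natl (mulrC m.+1%:R) divfK ?gt_eqF //.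
  rewrite lerXn2r // ?nnegrE ?expR_ge0 ?divr_ge0 ?ltW //.
  apply: lt_le_trans (expR_ge1Dx _).
  by rewrite ltrDr.
have tu : t * u = 1 by rewrite mulfV ?gt_eqF.
rewrite -(ler_pM2r u0) -[X in _ <= X]mulrA tu mulr1.
rewrite mulrAC -exprSr expRN ler_pdivrMr ?expR_gt0 //.
by rewrite -ler_pdivrMl ?exprn_gt0 // mulrC -expr_div_n.
Qed.

(** At t = 0 the difference quotient of the m-th function is the (m + 1)-st one,
which tends to 0 by flat_fun_le. *)
Lemma is_derive_flat_fun m t :
  is_derive t 1 (flat_fun m) (flat_fun m.+2 t - m%:R * flat_fun m.+1 t).
Proof.
case: (ltgtP t 0) => t0.
- have -> : flat_fun m.+2 t - m%:R * flat_fun m.+1 t = 0.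
    by rewrite /flat_fun ltNge (ltW t0) /= mulr0 subrr.
  apply: (@near_eq_is_derive _ _ _ (cst 0)).
  near=> s; rewrite /flat_fun ltNge ltW //=.
  by near: s; exact: lt_nbhsl.
- pose g := (fun s : R => s^-1 ^+ m * expR (- s^-1)).
  apply: (@near_eq_is_derive _ _ _ g).
    near=> s; rewrite /flat_fun ifT //.
    by near: s; exact: lt_nbhsr.
  have tn0 : t != 0 by rewrite gt_eqF.
  have dV : is_derive t 1 (fun s : R => s^-1) (- t ^- 2).
    apply: DeriveDef; first exact: derivableV.
    by rewrite deriveV // derive_id scaler1.
  have dX := is_deriveX m dV.
  have dN := is_deriveN dV.
  have dE : is_derive t 1 (fun s : R => expR (- s^-1)) (t ^- 2 * expR (- t^-1)).
    have := @is_derive1_comp R expR (fun s : R => - s^-1) t _ _ _ dN.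
    move=> /(_ _ (is_derive_expR _)); rewrite opprK mulrC.
    by rewrite (_ : expR \o _ = fun s => expR (- s^-1)).
  have := is_deriveM dX dE.
  rewrite (_ : _ * _ = g) ?fctE //.
  rewrite /flat_fun t0 => H; apply: is_derive_eq H _.
  rewrite -!exprVn; set a := t^-1; set b := expR _; rewrite /GRing.scale /=.
  by case: m {dX g} => [|m]; rewrite /= ?exprS ?expr0; ring.
rewrite t0 {t0 t}.
have -> : flat_fun m.+2 0 - m%:R * flat_fun m.+1 0 = 0 :> R.
  by rewrite /flat_fun ltxx mulr0 subrr.
have C : (fun h : R => h^-1 *: (flat_fun m (h *: 1 + 0) - flat_fun m 0)) @ 0^' --> (0 : R).
  rewrite (_ : (fun h => _) = fun h => flat_fun m.+1 h); last first.
    apply/funext => h; rewrite addr0 [_ *: 1]mulr1 /flat_fun ltxx subr0.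
    case: ifPn => h0; last by rewrite scaler0.
    by rewrite [LHS]mulrA exprS.
  pose c : R := m.+2%:R ^+ m.+2.
  apply: (squeeze_cvgr (f := cst 0) (h := fun h => c * `|h|)).
  - near=> h; rewrite flat_fun_ge0 /=.
    case: (ltP 0 h) => h0; first by rewrite gtr0_norm // flat_fun_le.
    by rewrite /flat_fun ltNge h0 /= mulr_ge0 // exprn_ge0.
  - exact: cvg_cst.
  - rewrite -[X in _ --> X](mulr0 c); apply: cvgM; first exact: cvg_cst.
    have C0 : (fun h : R => `|h|) @ (0 : R) --> (0 : R).
      by rewrite -[X in _ --> X](normr0 R); apply: cvg_norm; exact: cvg_id.
    by apply: cvg_trans C0 => A /= A0; exact: nbhs_dnbhs.
by apply: DeriveDef; [apply/cvg_ex; exists 0|exact: cvg_lim C].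
Unshelve. all: by end_near. Qed.

Lemma Ck_on_flat (V : normedModType R) k (U : set V) (u : V -> R) m :
  open U -> Ck_on k U u -> Ck_on k U (fun x => flat_fun m (u x)).
Proof.
have df j t : differentiable (@flat_fun j) t.
  by apply/derivable1_diffP; have [] := is_derive_flat_fun j t.
move=> oU; elim: k m => [|k IH] m cu.
  move=> x Ux; apply: (@continuous_comp _ _ _ u (flat_fun m)); first exact: cu.
  exact: differentiable_continuous.
have cuk : Ck_on k U u by exact: Ck_onW.
case: cu => du Du; split=> [x Ux|v].
  by apply: (@differentiable_comp _ _ _ _ u (flat_fun m)) => //; exact: du.
have cm j : Ck_on k U (fun x => (- j%:R) * flat_fun m.+1 (u x)).
  by apply: Ck_onM; [by []|exact: Ck_on_cst|exact: IH].
apply: (Ck_on_eq oU) (Ck_onM oU (Du v) (Ck_onD oU (IH m.+2 cuk) (cm m))) => x.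
rewrite inE => Ux.
rewrite [RHS]deriveE; last by apply: (@differentiable_comp _ _ _ _ u (flat_fun m)) => //; exact: du.
rewrite (@diff_comp _ _ _ _ u (flat_fun m)) //; last exact: du.
rewrite /= -[X in _ = 'd _ _ X]deriveE; last exact: du.
set a := 'D_v u x.
rewrite -[X in _ = 'd _ _ X]mulr1 linearZ /= -deriveE //.
have [_ ->] := is_derive_flat_fun m (u x).
by rewrite !fctE mulNr.
Qed.

End Flat.

Section Bump.
Context {R : realType}.

Lemma flat_fun0_gt0 (t : R) : 0 < t -> 0 < flat_fun 0 t.
Proof. by move=> t0; rewrite /flat_fun t0 mul1r expR_gt0. Qed.

Lemma flat_fun_eq0 m (t : R) : t <= 0 -> flat_fun m t = 0.
Proof. by move=> t0; rewrite /flat_fun ltNge t0. Qed.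

(** For r > 0, a smooth cutoff in s: 1 for |s| <= r / 2 and 0 for |s| >= r. The
denominator is positive since its two terms cannot vanish at once. *)
Definition plateau (r s : R) : R :=
  flat_fun 0 (r ^+ 2 - s ^+ 2) *
  (flat_fun 0 (r ^+ 2 - s ^+ 2) + flat_fun 0 (s ^+ 2 - (r / 2) ^+ 2))^-1.

Lemma plateau_den_gt0 (r s : R) : 0 < r ->
  0 < flat_fun 0 (r ^+ 2 - s ^+ 2) + flat_fun 0 (s ^+ 2 - (r / 2) ^+ 2).
Proof.
move=> r0; case: (ltP (s ^+ 2) (r ^+ 2)) => sr.
  by rewrite ltr_pwDl ?flat_fun_ge0 // flat_fun0_gt0 // subr_gt0.
rewrite ltr_wpDl ?flat_fun_ge0 // flat_fun0_gt0 // subr_gt0.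
apply: lt_le_trans sr; nra.
Qed.

Lemma plateau_eq1 (r s : R) : 0 < r -> `|s| <= r / 2 -> plateau r s = 1.
Proof.
move=> r0 sr; have := plateau_den_gt0 s r0; rewrite /plateau.
rewrite (@flat_fun_eq0 _ (s ^+ 2 - _)); last first.
  by rewrite subr_le0 -(real_normK (num_real s)) lerXn2r ?nnegrE ?divr_ge0 // ltW.
by rewrite addr0 => d0; rewrite mulfV // gt_eqF.
Qed.

Lemma plateau_eq0 (r s : R) : 0 < r -> r <= `|s| -> plateau r s = 0.
Proof.
move=> r0 sr; rewrite /plateau (@flat_fun_eq0 _ (r ^+ 2 - _)) ?mul0r //.
by rewrite subr_le0 -(real_normK (num_real s)) lerXn2r ?nnegrE // ltW.
Qed.

Lemma Ck_on_plateau (V : normedModType R) k (U : set V) (u : V -> R) r :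
  open U -> 0 < r -> Ck_on k U u -> Ck_on k U (fun x => plateau r (u x)).
Proof.
move=> oU r0 cu.
have c2 : Ck_on k U (fun x => u x ^+ 2) by exact: Ck_onM.
have c2' : Ck_on k U (fun x => - (u x ^+ 2)) by exact: Ck_onN.
have cf a (g : V -> R) : Ck_on k U g -> Ck_on k U (fun x => flat_fun 0 (a + g x)).
  move=> cg; apply: Ck_on_flat => //.
  by have := Ck_onD oU (Ck_on_cst (W := R^o) k U a) cg.
have c1 : Ck_on k U (fun x => flat_fun 0 (u x ^+ 2 - (r / 2) ^+ 2)).
  by apply: (Ck_on_eq oU) (cf (- (r / 2) ^+ 2) _ c2) => x _; rewrite addrC.
apply: Ck_onM => //; first exact: cf.
apply: Ck_onV => // [x _|]; first by rewrite gt_eqF // plateau_den_gt0.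
exact: (Ck_onD oU (cf _ _ c2') c1).
Qed.

Lemma coord_norm_le m (x : 'rV[R]_m) j : `|x 0 j| <= `|x|.
Proof.
rewrite [leRHS]/Num.Def.normr/= mx_normrE.
by have := @le_bigmax _ _ _ 0 (fun ij => `|x ij.1 ij.2|) (0, j).
Qed.

Lemma norm_le_coord m (x : 'rV[R]_m) r :
  0 <= r -> (forall j, `|x 0 j| <= r) -> `|x| <= r.
Proof.
move=> r0 H; rewrite /Num.Def.normr/= mx_normrE bigmax_le //= => -[i j] _ /=.
by rewrite ord1.
Qed.

(** A product of one-variable plateaus; its support is a cube, which is compact. *)
Lemma bump_exists n (A : set 'rV[R]_n) x0 : open A -> A x0 ->
  exists (phi : 'rV[R]_n -> R) (K : set 'rV[R]_n),
    [/\ smooth_on setT phi, compact K, K `<=` A,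
        forall x, ~ K x -> phi x = 0 & \forall x \near x0, phi x = 1].
Proof.
move=> oA Ax0; have /nbhs_ballP[e /= e0 eA] := open_nbhs_nbhs (conj oA Ax0).
pose r := e / 2; have r0 : 0 < r by rewrite divr_gt0.
pose K := [set x : 'rV[R]_n | forall j, `[x0 0 j - r, x0 0 j + r]%classic (x 0 j)].
exists (fun x => \prod_j plateau r (x 0 j - x0 0 j)), K; split.
- move=> k; apply: Ck_on_prod => [|j]; first exact: openT.
  apply: Ck_on_plateau => //; first exact: openT.
  have cj : Ck_on k setT (fun x : 'rV[R]_n => x 0 j).
    apply: Ck_on_coord; first exact: openT.
    by apply: (@Ck_on_linear _ _ _ _ _ idfun) => x; exact: cvg_id.
  have := Ck_onD openT cj (Ck_on_cst (W := R^o) k setT (- x0 0 j)).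
  by [].
- by apply: (@rV_compact _ _ (fun j => `[x0 0 j - r, x0 0 j + r]%classic)) => j;
    exact: segment_compact.
- move=> x Kx; apply: eA; rewrite -ball_normE /=.
  apply: (@le_lt_trans _ _ r); last by rewrite /r; lra.
  apply: norm_le_coord => [|j]; first exact: ltW.
  by move: (Kx j); rewrite /= in_itv /= !mxE ler_norml => /andP[? ?]; apply/andP; split; lra.
- move=> x /existsNP[j Kj]; rewrite (bigD1 j) //= plateau_eq0 ?mul0r //.
  rewrite leNgt ltr_norml; apply/negP => /andP[H1 H2]; apply: Kj.
  by rewrite /= in_itv /=; apply/andP; split; lra.
- have r2 : 0 < r / 2 by rewrite divr_gt0.
  near=> x; rewrite big1 // => j _; apply: plateau_eq1 => //.
  rewrite distrC -[X in X <= _]/(`|x0 0 j - x 0 j|).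
  have -> : x0 0 j - x 0 j = (x0 - x) 0 j by rewrite !mxE.
  apply: le_trans (coord_norm_le _ _) _; apply: ltW.
  have : ball x0 (r / 2) x by near: x; exact: nbhsx_ballx.
  by rewrite -ball_normE.
Unshelve. all: by end_near. Qed.

End Bump.

(** * Extension by zero from a chart *)

Lemma Ck_on_mulmx (R : realType) (V : normedModType R) k (U : set V) m l
    (h : V -> 'rV[R]_m) (B : V -> 'M[R]_(m, l)) : open U ->
  Ck_on k U h -> (forall a b, Ck_on k U (fun x => B x a b)) ->
  Ck_on k U (fun x => h x *m B x).
Proof.
move=> oU ch cB; apply: Ck_on_row => // b.
apply: (Ck_on_eq oU) (Ck_on_sum (f := fun a x => h x 0 a * B x a b) oU _).
  by move=> x _; rewrite mxE.
by move=> a; apply: Ck_onM => //; exact: Ck_on_coord.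
Qed.

Section ManifoldTopology.
Context {R : realType} {n : nat} (M : manifold R n).
Implicit Types (p q : M) (i j : mchart M) (K : set 'rV[R]_n).

Lemma chart_open i : open (mcoord i @` mdom i).
Proof. by have := overlap_open M i i; rewrite setIid. Qed.

Lemma overlap_sub i j :
  mcoord i @` (mdom i `&` mdom j) `<=` mcoord i @` mdom i.
Proof. by move=> _ [p [ip _] <-]; exists p. Qed.

(** In a Hausdorff manifold the compact subset of a chart domain with coordinates
in K is closed: otherwise the points of it that are close to q in the chart j
form a proper filter, whose trace in the chart i clusters at some point p' of K,
and p' cannot be separated from q. *)
Lemma chart_compact_closed i j K q : compact K -> K `<=` mcoord i @` mdom i ->
  mdom j q -> ~ (mdom i q /\ K (mcoord i q)) ->
  exists P : set 'rV[R]_n, [/\ open P, P (mcoord j q), P `<=` mcoord j @` mdom j &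
    forall p, mdom j p -> P (mcoord j p) -> ~ (mdom i p /\ K (mcoord i p))].
Proof.
move=> cK KU jq nKq; apply: contrapT => H.
pose S := mcoord j @` (mdom j `&` [set p | mdom i p /\ K (mcoord i p)]).
have clS : closure S (mcoord j q).
  move=> B Bq; apply: contrapT => SB; apply: H.
  have [P [oP Pq PB]] : exists P : set 'rV[R]_n,
      [/\ open P, P (mcoord j q) & P `<=` B].
    by move: Bq; rewrite nbhsE => -[P [oP Pq] PB]; exists P.
  exists (P `&` mcoord j @` mdom j); split.
  - by apply: openI => //; exact: chart_open.
  - by split => //; exists q.
  - by move=> x [].
  - by move=> p jp [Pp _] Kp; apply: SB; exists (mcoord j p); split;
      [exists p|exact: PB].
have PF := within_nbhs_proper clS.
pose F := (mcoord i \o mparam j) @ within S (nbhs (mcoord j q)).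
have FK : F K.
  by rewrite /F /= /nbhs /= /within /=; near=> z => -[p [jp [ip Kp]] <-]; rewrite mcoordK.
have [k [Kk Fk]] := cK F _ FK.
have [p' ip' pk] := KU k Kk.
have qp' : q <> p' by move=> qp'; apply: nKq; rewrite qp' pk.
have [A [B [oA oB Aq Bp AB]]] := charts_hausdorff qp'.
have FA : F [set x | A (mparam i x)].
  rewrite /F /= /nbhs /= /within /=.
  have : nbhs (mcoord j q) (mcoord j @` (mdom j `&` A)).
    by apply: open_nbhs_nbhs; split; [exact: oA|exists q].
  apply: filterS => z [p [jp Ap] <-] [p1 [jp1 [ip1 _]] E] /=.
  have -> : mparam j (mcoord j p) = p1 by rewrite -E mcoordK.
  by rewrite mcoordK // -[p1](mcoordK _ j) // E mcoordK.
have kB : nbhs k (mcoord i @` (mdom i `&` B)).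
  by apply: open_nbhs_nbhs; split; [exact: oB|exists p'].
have [x [/= Ax [p [ip Bp1] px]]] := Fk _ _ FA kB.
have : (A `&` B) p by split => //; rewrite -[p](mcoordK _ i) // px.
by rewrite AB.
Unshelve. all: by end_near. Qed.

Definition chart_supported i (V : normedModType R) (h : 'rV[R]_n -> V) : Prop :=
  exists K, [/\ compact K, K `<=` mcoord i @` mdom i & forall x, ~ K x -> h x = 0].

(** A point of the chart j either lies in the chart i, or has a neighbourhood that
avoids the compact set, where f vanishes. *)
Lemma smooth_on_glue i j K (W : normedModType R) (f : 'rV[R]_n -> W) :
  compact K -> K `<=` mcoord i @` mdom i ->
  smooth_on (mcoord j @` (mdom j `&` mdom i)) f ->
  (forall p, mdom j p -> ~ (mdom i p /\ K (mcoord i p)) -> f (mcoord j p) = 0) ->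
  smooth_on (mcoord j @` mdom j) f.
Proof.
move=> cK KU sf f0 k; apply: Ck_on_local => _ [p jp <-].
have [ip|nip] := pselect (mdom i p).
  exists (mcoord j @` (mdom j `&` mdom i)); split; last exact: sf.
    exact: overlap_open.
  by exists p.
have [|P [oP Pp PU P0]] := chart_compact_closed cK KU jp; first by case.
exists P; split => //; apply: (Ck_on_eq oP) (Ck_on_cst (W := W) k P 0) => x.
by rewrite inE => Px; have [p1 jp1 E] := PU x Px; rewrite -E f0 //; apply: P0; rewrite // E.
Qed.

Lemma smooth_on_jac i j l m :
  smooth_on (mcoord i @` (mdom i `&` mdom j)) (fun x => jac i j (mparam i x) l m).
Proof.
move=> k; have oU := overlap_open M i j.
have [_ /(_ 'e_l) tD] := transition_smooth M i j k.+1.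
apply: (Ck_on_eq oU) (Ck_on_coord m oU tD) => x; rewrite inE => -[p [ip jp] <-].
rewrite /jac jacobian_derive ?(mcoordK _ i) //.
exact: differentiable_transition.
Qed.

(** The same matrix as in smooth_on_jac, seen in the target chart of the
transition. *)
Lemma smooth_on_jacV i j l m :
  smooth_on (mcoord j @` (mdom j `&` mdom i)) (fun x => jac i j (mparam j x) l m).
Proof.
move=> k; have oU := overlap_open M j i.
apply: (Ck_on_eq oU) (Ck_on_comp_R oU (overlap_open M i j) (@transitionE _ _ M j i)
  (transition_smooth M j i k) (@smooth_on_jac i j l m k)) => x.
by rewrite inE => -[p [jp ip] <-] /=; rewrite !mcoordK.
Qed.

Lemma vec_in_change i j p (X : M -> 'rV[R]_n) : mdom i p -> mdom j p ->
  vec_in j X (mcoord j p) = vec_in i X (mcoord i p) *m jac i j p.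
Proof.
move=> ip jp; have cp := mchart_atP p.
by rewrite /vec_in (mcoordK _ _ _ ip) (mcoordK _ _ _ jp) -mulmxA (jac_comp cp ip jp).
Qed.

Lemma covec_in_change i j p (a : M -> 'rV[R]_n) : mdom i p -> mdom j p ->
  covec_in j a (mcoord j p) = covec_in i a (mcoord i p) *m (jac j i p)^T.
Proof.
move=> ip jp; have cp := mchart_atP p.
by rewrite /covec_in (mcoordK _ _ _ ip) (mcoordK _ _ _ jp) -mulmxA -trmx_mul (jac_comp jp ip cp).
Qed.

Lemma vec_in_at (X : M -> 'rV[R]_n) p :
  vec_in (mchart_at p) X (mcoord (mchart_at p) p) = X p.
Proof.
have pp := mchart_atP p.
by rewrite /vec_in mcoordK // (jac_id pp) mulmx1.
Qed.

(** The function, vector field and covector field on M with the representative h in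
the chart i, continued by zero. *)
Definition ext_fun i (h : 'rV[R]_n -> R) : M -> R :=
  fun p => if `[< mdom i p >] then h (mcoord i p) else 0.
Definition ext_vec i (h : 'rV[R]_n -> 'rV[R]_n) : M -> 'rV[R]_n :=
  fun p => if `[< mdom i p >] then h (mcoord i p) *m jac i (mchart_at p) p else 0.
Definition ext_cov i (h : 'rV[R]_n -> 'rV[R]_n) : M -> 'rV[R]_n :=
  fun p => if `[< mdom i p >] then h (mcoord i p) *m (jac (mchart_at p) i p)^T else 0.

Lemma ext_funE i h p : mdom i p -> ext_fun i h p = h (mcoord i p).
Proof. by move=> ip; rewrite /ext_fun; case: asboolP. Qed.

Lemma vec_in_ext i h p : mdom i p -> vec_in i (ext_vec i h) (mcoord i p) = h (mcoord i p).
Proof.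
move=> ip; rewrite /vec_in mcoordK // /ext_vec; case: asboolP => // _.
by rewrite -mulmxA (jac_comp ip (mchart_atP p) ip) (jac_id ip) mulmx1.
Qed.

Lemma covec_in_ext i h p : mdom i p ->
  covec_in i (ext_cov i h) (mcoord i p) = h (mcoord i p).
Proof.
move=> ip; rewrite /covec_in mcoordK // /ext_cov; case: asboolP => // _.
by rewrite -mulmxA -trmx_mul (jac_comp ip (mchart_atP p) ip) (jac_id ip) trmx1 mulmx1.
Qed.

Lemma smooth_on_transition i j (h : 'rV[R]_n -> 'rV[R]_n) :
  smooth_on (mcoord i @` mdom i) h ->
  smooth_on (mcoord j @` (mdom j `&` mdom i)) (h \o (mcoord i \o mparam j)).
Proof.
move=> sh k; apply: (Ck_on_comp _ (overlap_open M i j) (@transitionE _ _ M j i)).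
- exact: overlap_open.
- exact: transition_smooth.
- apply: Ck_on_sub (sh k); exact: overlap_sub.
Qed.

Lemma smooth_ext_fun i h : smooth_on (mcoord i @` mdom i) h ->
  chart_supported i h -> smooth_fun (ext_fun i h).
Proof.
move=> sh [K [cK KU h0]] j; apply: (smooth_on_glue cK KU) => [k|p jp nK].
  have oU := overlap_open M j i.
  apply: (Ck_on_eq oU) (Ck_on_comp_R oU (overlap_open M i j) (@transitionE _ _ M j i)
    (transition_smooth M j i k) (Ck_on_sub (@overlap_sub i j) (sh k))) => x.
  by rewrite inE => -[p [jp ip] <-] /=; rewrite mcoordK // ext_funE.
rewrite /= mcoordK // /ext_fun; case: asboolP => // ip; apply: h0 => Kp.
exact: nK.
Qed.

Lemma smooth_ext_vec i h : smooth_on (mcoord i @` mdom i) h ->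
  chart_supported i h -> smooth_field (ext_vec i h).
Proof.
move=> sh [K [cK KU h0]] j; apply: (smooth_on_glue cK KU) => [k|p jp nK].
  have oU := overlap_open M j i.
  apply: (Ck_on_eq oU) (Ck_on_mulmx oU (smooth_on_transition j sh k)
    (fun l m => @smooth_on_jacV i j l m k)) => x.
  rewrite inE => -[p [jp ip] <-] /=; rewrite (mcoordK _ _ _ jp).
  by rewrite (vec_in_change _ ip jp) vec_in_ext.
rewrite /vec_in mcoordK // /ext_vec; case: asboolP => [ip|_]; last exact: mul0mx.
by rewrite h0 ?mul0mx // => Kp; exact: nK.
Qed.

Lemma smooth_ext_cov i h : smooth_on (mcoord i @` mdom i) h ->
  chart_supported i h -> smooth_form (ext_cov i h).
Proof.
move=> sh [K [cK KU h0]] j; apply: (smooth_on_glue cK KU) => [k|p jp nK].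
  have oU := overlap_open M j i.
  apply: (Ck_on_eq oU) (Ck_on_mulmx (B := fun x => (jac j i (mparam j x))^T) oU
    (smooth_on_transition j sh k) _) => [x|l m].
    rewrite inE => -[p [jp ip] <-] /=; rewrite (mcoordK _ _ _ jp).
    by rewrite (covec_in_change _ ip jp) covec_in_ext.
  apply: (Ck_on_eq oU) (@smooth_on_jac j i m l k) => x _; by rewrite [RHS]mxE.
rewrite /covec_in mcoordK // /ext_cov; case: asboolP => [ip|_]; last exact: mul0mx.
by rewrite h0 ?mul0mx // => Kp; exact: nK.
Qed.

End ManifoldTopology.
Arguments chart_open {R n M} i.

(** * Functions, fields and forms in charts *)

Definition dot (R : realType) m (a v : 'rV[R]_m) : R := (a *m v^T) 0 0.

Section Dot.
Context {R : realType} {m : nat}.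
Implicit Types a b u v : 'rV[R]_m.

Lemma dotE a v : dot a v = \sum_j a 0 j * v 0 j.
Proof. by rewrite /dot mxE; apply: eq_bigr => j _; rewrite mxE. Qed.

Lemma dotDr a u v : dot a (u + v) = dot a u + dot a v.
Proof. by rewrite /dot linearD mulmxDr mxE. Qed.

Lemma dotZr a c v : dot a (c *: v) = c * dot a v.
Proof. by rewrite /dot linearZ -scalemxAr mxE. Qed.

Lemma dotBr a u v : dot a (u - v) = dot a u - dot a v.
Proof. by rewrite dotDr -scaleN1r dotZr mulN1r. Qed.

Lemma dot0r a : dot a 0 = 0.
Proof. by rewrite /dot trmx0 mulmx0 mxE. Qed.

Lemma dot0l a : dot 0 a = 0.
Proof. by rewrite /dot mul0mx mxE. Qed.

Lemma dot_delta a l : dot a (delta_mx 0 l) = a 0 l.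
Proof.
rewrite dotE (bigD1 l) //= big1 => [|j jl]; first by rewrite mxE !eqxx mulr1 addr0.
by rewrite mxE (negbTE jl) andbF mulr0.
Qed.

Lemma dot_mulmxl k a (A : 'M[R]_(m, k)) (v : 'rV[R]_k) :
  dot (a *m A) v = dot a (v *m A^T).
Proof. by rewrite /dot trmx_mul trmxK mulmxA. Qed.

End Dot.

Section DotCalculus.
Context {R : realType} {V : normedModType R} {m : nat}.
Implicit Types (f g : V -> 'rV[R]_m) (h : V -> R).

Lemma Ck_on_dot k (U : set V) f g : open U -> Ck_on k U f -> Ck_on k U g ->
  Ck_on k U (fun x => dot (f x) (g x)).
Proof.
move=> oU cf cg.
apply: (Ck_on_eq oU) (Ck_on_sum (f := fun a x => f x 0 a * g x 0 a) oU _).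
  by move=> x _; rewrite dotE.
by move=> a; apply: Ck_onM => //; exact: Ck_on_coord.
Qed.

Lemma Ck_on_scale k (U : set V) h f : open U -> Ck_on k U h -> Ck_on k U f ->
  Ck_on k U (fun x => h x *: f x).
Proof.
move=> oU ch cf; apply: Ck_on_row => // j.
apply: (Ck_on_eq oU) (Ck_onM oU ch (Ck_on_coord j oU cf)) => x _.
by rewrite [RHS]mxE.
Qed.

Lemma derive_coord f v x j : derivable f x v ->
  'D_v f x 0 j = 'D_v (fun y => f y 0 j) x.
Proof. by move=> df; rewrite derive_mx // mxE. Qed.

Lemma derive_dot f g v x : differentiable f x -> differentiable g x ->
  'D_v (fun y => dot (f y) (g y)) x = dot ('D_v f x) (g x) + dot (f x) ('D_v g x).
Proof.
move=> df dg.
have dfv : derivable f x v by exact: diff_derivable.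
have dgv : derivable g x v by exact: diff_derivable.
rewrite (_ : (fun y => _) = \sum_j ((fun y => f y 0 j) * (fun y => g y 0 j))); last first.
  by apply/funext => y; rewrite fct_sumE dotE.
have cf j : derivable (fun y => f y 0 j) x v by have /derivable_mxP := dfv; apply.
have cg j : derivable (fun y => g y 0 j) x v by have /derivable_mxP := dgv; apply.
rewrite derive_sum => [|j]; last exact: derivableM.
rewrite !dotE -big_split; apply: eq_bigr => j _ /=.
rewrite (deriveM (cf j) (cg j)) (derive_coord _ dfv) (derive_coord _ dgv).
by rewrite addrC; congr (_ + _); exact: mulrC.
Qed.

Lemma derive_sum_coord (f : 'rV[R]_m -> R) x v : differentiable f x ->
  'D_v f x = \sum_l v 0 l * 'D_(delta_mx 0 l) f x.
Proof.
move=> df; rewrite deriveE // {1}(row_sum_delta v) linear_sum.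
by apply: eq_bigr => l _; rewrite linearZ /= deriveE.
Qed.

End DotCalculus.

Section ManifoldCalculus.
Context {R : realType} {n : nat} {M : manifold R n}.
Implicit Types (p q : M) (i j : mchart M) (X Y Z a : M -> 'rV[R]_n) (f g : M -> R).

Lemma smooth_fun_cst (c : R) : smooth_fun (cst c : M -> R).
Proof. by move=> i k; exact: Ck_on_cst. Qed.

Lemma smooth_funD f g : smooth_fun f -> smooth_fun g -> smooth_fun (f + g).
Proof. by move=> sf sg i k; apply: Ck_onD; [exact: chart_open|exact: sf|exact: sg]. Qed.

Lemma smooth_funN f : smooth_fun f -> smooth_fun (- f).
Proof. by move=> sf i k; apply: Ck_onN; [exact: chart_open|exact: sf]. Qed.

Lemma vec_inD i X Y x : vec_in i (X + Y) x = vec_in i X x + vec_in i Y x.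
Proof. by rewrite /vec_in mulmxDl. Qed.

Lemma vec_in0 i x : vec_in i (0 : M -> 'rV[R]_n) x = 0.
Proof. by rewrite /vec_in mul0mx. Qed.

Lemma vec_inB i X Y x : vec_in i (X - Y) x = vec_in i X x - vec_in i Y x.
Proof. by rewrite /vec_in mulmxBl. Qed.

Lemma vec_in_fscale i f X x :
  vec_in i (fscale f X) x = f (mparam i x) *: vec_in i X x.
Proof. by rewrite /vec_in /fscale scalemxAl. Qed.

Lemma smooth_field0 : smooth_field (0 : M -> 'rV[R]_n).
Proof.
move=> i k; rewrite (_ : vec_in i 0 = cst 0); first exact: Ck_on_cst.
by apply/funext => x; rewrite vec_in0.
Qed.

Lemma smooth_fieldD X Y : smooth_field X -> smooth_field Y -> smooth_field (X + Y).
Proof.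
move=> sX sY i k; rewrite (_ : vec_in i _ = vec_in i X + vec_in i Y).
  by apply: Ck_onD; [exact: chart_open|exact: sX|exact: sY].
by apply/funext => x; rewrite vec_inD.
Qed.

Lemma smooth_field_fscale f X : smooth_fun f -> smooth_field X ->
  smooth_field (fscale f X).
Proof.
move=> sf sX i k; rewrite (_ : vec_in i _ = fun x => f (mparam i x) *: vec_in i X x).
  by apply: Ck_on_scale; [exact: chart_open|exact: sf|exact: sX].
by apply/funext => x; rewrite vec_in_fscale.
Qed.

Lemma smooth_fieldZ c X : smooth_field X -> smooth_field (c *: X).
Proof.
move=> sX; rewrite (_ : _ *: _ = fscale (cst c) X) //.
by apply: smooth_field_fscale => //; exact: smooth_fun_cst.
Qed.

Lemma smooth_fieldB X Y : smooth_field X -> smooth_field Y -> smooth_field (X - Y).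
Proof.
by move=> sX sY; rewrite -scaleN1r; apply: smooth_fieldD => //; exact: smooth_fieldZ.
Qed.

Lemma ev_chart i p a Z : mdom i p ->
  ev a Z p = dot (covec_in i a (mcoord i p)) (vec_in i Z (mcoord i p)).
Proof.
move=> ip; have cp := mchart_atP p.
rewrite /covec_in /vec_in (mcoordK _ _ _ ip) dot_mulmxl trmxK -mulmxA.
by rewrite (jac_comp cp ip cp) (jac_id cp) mulmx1.
Qed.

Lemma smooth_ev a Z : smooth_form a -> smooth_field Z -> smooth_fun (ev a Z).
Proof.
move=> sa sZ i k; have oU := chart_open i.
apply: (Ck_on_eq oU) (Ck_on_dot oU (sa i k) (sZ i k)) => x.
by rewrite inE => -[p ip <-]; rewrite /= (mcoordK _ _ _ ip) (ev_chart _ _ ip).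
Qed.

(** The definition of X f uses the preferred chart of p; by the chain rule any
chart will do. *)
Lemma deriv_chart i p X f : smooth_fun f -> mdom i p ->
  deriv X f p = 'D_(vec_in i X (mcoord i p)) (f \o mparam i) (mcoord i p).
Proof.
move=> sf ip; have cp := mchart_atP p; rewrite /deriv.
set c := mchart_at p in cp *.
have dt := differentiable_transition cp ip.
have -> : vec_in i X (mcoord i p) = 'D_(X p) (mcoord i \o mparam c) (mcoord c p).
  by rewrite (vec_in_change _ cp ip) /c vec_in_at /jac deriveEjacobian.
have df : differentiable (f \o mparam i) (mcoord i p).
  by apply: (smooth_on_differentiable (sf i)); exists p.
have pE : (mcoord i \o mparam c) (mcoord c p) = mcoord i p.
  by rewrite /= (mcoordK _ _ _ cp).
rewrite (derive_comp (X p) pE dt df).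
apply: (@derive_eq_on _ _ _ (mcoord c @` (mdom c `&` mdom i))).
- exact: overlap_open.
- by move=> x; rewrite inE => -[q [cq iq] <-]; rewrite /= !mcoordK.
- by rewrite inE; exists p.
Qed.

Lemma smooth_deriv X f : smooth_field X -> smooth_fun f -> smooth_fun (deriv X f).
Proof.
move=> sX sf i k; have oU := chart_open i.
have [_ Df] := sf i k.+1.
apply: (Ck_on_eq oU) (Ck_on_sum (f := fun l x =>
  vec_in i X x 0 l * 'D_(delta_mx 0 l) (f \o mparam i) x) oU _) => [x|l].
  rewrite inE => -[p ip <-] /=; rewrite (mcoordK _ _ _ ip) (deriv_chart _ sf ip).
  rewrite -derive_sum_coord //.
  by apply: (smooth_on_differentiable (sf i)); exists p.
by apply: Ck_onM => //; [apply: Ck_on_coord => //; exact: sX|exact: Df].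
Qed.

Lemma near_chart i p (P : 'rV[R]_n -> Prop) : mdom i p ->
  (forall q, mdom i q -> P (mcoord i q)) -> \forall x \near mcoord i p, P x.
Proof.
move=> ip H; have := open_nbhs_nbhs (conj (chart_open i) (ex_intro2 _ _ p ip erefl)).
by apply: filterS => _ [q iq <-]; exact: H.
Qed.

(** Multiplication by phi makes the three extensions by zero smooth, and does not
change the representatives near p. *)
Lemma local_cutoff i p : mdom i p -> exists phi : 'rV[R]_n -> R,
  [/\ (\forall x \near mcoord i p, phi x = 1),
      forall g : 'rV[R]_n -> R, smooth_on (mcoord i @` mdom i) g ->
        smooth_fun (ext_fun i (fun x => phi x * g x)),
      forall v : 'rV[R]_n -> 'rV[R]_n, smooth_on (mcoord i @` mdom i) v ->
        smooth_field (ext_vec i (fun x => phi x *: v x)) &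
      forall v : 'rV[R]_n -> 'rV[R]_n, smooth_on (mcoord i @` mdom i) v ->
        smooth_form (ext_cov i (fun x => phi x *: v x))].
Proof.
move=> ip; have oU := chart_open i.
have [phi [K [sphi cK KU phi0 phi1]]] :=
  bump_exists oU (ex_intro2 _ _ p ip erefl).
have sphiU : smooth_on (mcoord i @` mdom i) phi.
  by move=> k; exact: Ck_on_sub (sphi k).
exists phi; split => // [g sg|v sv|v sv].
- apply: smooth_ext_fun => [k|]; first by apply: Ck_onM.
  by exists K; split => // x nK; rewrite phi0 ?mul0r.
- apply: smooth_ext_vec => [k|]; first by apply: Ck_on_scale.
  by exists K; split => // x nK; rewrite phi0 ?scale0r.
- apply: smooth_ext_cov => [k|]; first by apply: Ck_on_scale.
  by exists K; split => // x nK; rewrite phi0 ?scale0r.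
Qed.

(** Coordinate fields multiplied by a cutoff. With f and g_l the extensions by zero
of phi and phi Z^l, the identity f^2 Z = sum_l g_l E_l holds on all of M, so it
can be fed to an F that is only defined on global fields; at p one has f = 1 and
g_l = Z^l. *)
Lemma local_frame i p : mdom i p -> exists E : 'I_n -> M -> 'rV[R]_n,
  [/\ forall l, smooth_field (E l),
      \forall x \near mcoord i p, forall l, vec_in i (E l) x = delta_mx 0 l &
      forall F : (M -> 'rV[R]_n) -> R,
        (forall Y Z, smooth_field Y -> smooth_field Z -> F (Y + Z) = F Y + F Z) ->
        (forall f Z, smooth_fun f -> smooth_field Z ->
          F (fscale f Z) = f p * F Z) ->
        forall Z, smooth_field Z ->
          F Z = \sum_l vec_in i Z (mcoord i p) 0 l * F (E l)].
Proof.
move=> ip; have [phi [phi1 sext svec _]] := local_cutoff ip.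
pose E l := ext_vec i (fun x => phi x *: (delta_mx 0 l : 'rV[R]_n)) : M -> 'rV[R]_n.
have sE l : smooth_field (E l) by apply: (svec (cst _)) => k; exact: Ck_on_cst.
exists E; split => // [|F FD FZ Z sZ].
  have H : \forall x \near mcoord i p, forall l, vec_in i (E l) x = phi x *: delta_mx 0 l.
    by apply: near_chart => // q iq l; rewrite vec_in_ext.
  by apply: filterS2 phi1 H => x phix H l; rewrite H phix scale1r.
have phip : phi (mcoord i p) = 1 by exact: (nbhs_singleton phi1).
pose f := ext_fun i (fun x => phi x * 1) : M -> R.
pose g l := ext_fun i (fun x => phi x * vec_in i Z x 0 l) : M -> R.
have sf : smooth_fun f by apply: (sext (cst 1)) => k; exact: Ck_on_cst.
have sg l : smooth_fun (g l).
  by apply: sext => k; apply: Ck_on_coord; [exact: chart_open|exact: sZ].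
have fp : f p = 1 by rewrite /f ext_funE // phip mulr1.
have gp l : g l p = vec_in i Z (mcoord i p) 0 l by rewrite /g ext_funE // phip mul1r.
have decomp : fscale f (fscale f Z) = \sum_l fscale (g l) (E l).
  apply/funext => q; rewrite fct_sumE /fscale /f /g /E /ext_fun /ext_vec.
  case: asboolP => iq; last by rewrite scale0r big1 // => l _; rewrite scale0r.
  have cq := mchart_atP q; rewrite mulr1.
  transitivity (phi (mcoord i q) *: (phi (mcoord i q) *: (vec_in i Z (mcoord i q) *m jac i (mchart_at q) q))).
    rewrite /vec_in (mcoordK _ _ _ iq) -mulmxA (jac_comp cq iq cq) (jac_id cq).
    by rewrite mulmx1.
  rewrite {1}(row_sum_delta (vec_in i Z _)) mulmx_suml !scaler_sumr.
  apply: eq_bigr => l _; rewrite -!scalemxAl !scalerA; congr (_ *: _).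
  by rewrite -mulrA [_ * phi _]mulrC.
have F0 : F 0 = 0.
  by apply: (addIr (F 0)); rewrite -FD ?addr0 ?add0r //; exact: smooth_field0.
have -> : F Z = F (fscale f (fscale f Z)).
  by rewrite !FZ ?fp ?mul1r //; exact: smooth_field_fscale.
rewrite decomp.
suff [_ ->] : smooth_field (\sum_l fscale (g l) (E l)) /\
    F (\sum_l fscale (g l) (E l)) = \sum_l F (fscale (g l) (E l)).
  by apply: eq_bigr => l _; rewrite FZ // gp.
elim/big_rec2 : _ => [|l Y r _ [sY <-]]; first by split; [exact: smooth_field0|].
have sgE : smooth_field (fscale (g l) (E l)) by exact: smooth_field_fscale.
by rewrite FD //; split => //; exact: smooth_fieldD.
Qed.

End ManifoldCalculus.

(** * Tensorial maps and the dual connection *)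

Lemma near_open (T : topologicalType) (x : T) (Q : T -> Prop) :
  (\forall y \near x, Q y) ->
  exists P : set T, [/\ open P, P x & forall y, P y -> Q y].
Proof.
move=> H; have : nbhs x Q by [].
by rewrite nbhsE => -[P [oP Px] PQ]; exists P.
Qed.

Section Tensors.
Context {R : realType} {n : nat} {M : manifold R n}.
Implicit Types (p q : M) (i j : mchart M) (X Y Z a : M -> 'rV[R]_n) (f g : M -> R).

Lemma ev_at a Z p : ev a Z p = dot (a p) (Z p).
Proof. by []. Qed.

Lemma evDr a Y Z : ev a (Y + Z) = ev a Y + ev a Z.
Proof. by apply/funext => p; rewrite !fctE /= !ev_at dotDr. Qed.

Lemma ev_fscale a f Z : ev a (fscale f Z) = (fun p => f p * ev a Z p).
Proof. by apply/funext => p; rewrite !ev_at dotZr. Qed.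

Lemma smooth_fun_at f i p : smooth_fun f -> mdom i p ->
  differentiable (f \o mparam i) (mcoord i p).
Proof. by move=> sf ip; apply: (smooth_on_differentiable (sf i)); exists p. Qed.

Lemma smooth_field_at Z i p : smooth_field Z -> mdom i p ->
  differentiable (vec_in i Z) (mcoord i p).
Proof. by move=> sZ ip; apply: (smooth_on_differentiable (sZ i)); exists p. Qed.

Lemma derivDr X f g p : smooth_fun f -> smooth_fun g ->
  deriv X (f + g) p = deriv X f p + deriv X g p.
Proof.
move=> sf sg; rewrite /deriv -deriveD //; apply: diff_derivable;
  exact: smooth_fun_at (mchart_atP p).
Qed.

Lemma derivMr X f g p : smooth_fun f -> smooth_fun g ->
  deriv X (fun q => f q * g q) p = deriv X f p * g p + f p * deriv X g p.
Proof.
move=> sf sg; have cp := mchart_atP p; rewrite /deriv.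
rewrite [LHS](deriveM (f := f \o mparam (mchart_at p)) (g := g \o mparam (mchart_at p))).
- rewrite /= !(mcoordK _ _ _ cp) addrC; congr (_ + _); exact: mulrC.
- by apply: diff_derivable; exact: smooth_fun_at.
- by apply: diff_derivable; exact: smooth_fun_at.
Qed.

Lemma derivDl X Y f p : smooth_fun f ->
  deriv (X + Y) f p = deriv X f p + deriv Y f p.
Proof.
move=> sf; have df := smooth_fun_at sf (mchart_atP p).
by rewrite /deriv !deriveE // linearD.
Qed.

Lemma deriv_fscale X f g p : smooth_fun f ->
  deriv (fscale g X) f p = g p * deriv X f p.
Proof.
move=> sf; have df := smooth_fun_at sf (mchart_atP p).
by rewrite /deriv !deriveE // linearZ.
Qed.

(** Near a point the components of a form are its values on a coordinate frame. *)
Lemma smooth_form_of_ev a :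
  (forall Z, smooth_field Z -> smooth_fun (ev a Z)) -> smooth_form a.
Proof.
move=> sa i; apply: smooth_on_near => _ [p ip <-].
have [E [sE Edelta _]] := local_frame ip.
have [P [oP Pp PE]] := near_open Edelta.
have oU := chart_open i.
have oPU : open (P `&` mcoord i @` mdom i) by exact: openI.
exists (P `&` mcoord i @` mdom i), (fun x => \row_l ev a (E l) (mparam i x)).
split; [by []|by split => //; exists p| |].
  move=> k; apply: Ck_on_row => // l.
  apply: (@Ck_on_eq _ _ _ _ _ (ev a (E l) \o mparam i)) => //.
    by move=> x _; rewrite [RHS]mxE.
  by apply: Ck_on_sub (sa _ (sE l) i k) => x [].
move=> x; rewrite inE => -[Px [q iq qx]]; apply/rowP => l /=; rewrite [RHS]mxE -qx.
rewrite (mcoordK _ _ _ iq) (ev_chart _ _ iq) qx.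
by rewrite (PE x Px l) dot_delta.
Qed.

(** By local_frame, F Z p is a linear function of Z p at every point p; the covectors
so obtained form a smooth form by smooth_form_of_ev. *)
Lemma form_of_spec (F : (M -> 'rV[R]_n) -> M -> R) :
  (forall Z, smooth_field Z -> smooth_fun (F Z)) ->
  (forall Y Z, smooth_field Y -> smooth_field Z -> forall p,
    F (Y + Z) p = F Y p + F Z p) ->
  (forall f Z, smooth_fun f -> smooth_field Z -> forall p,
    F (fscale f Z) p = f p * F Z p) ->
  forall Z, smooth_field Z -> forall p, ev (form_of F) Z p = F Z p.
Proof.
move=> sF FD FZ.
have H p : exists v, forall Z, smooth_field Z -> F Z p = dot v (Z p).
  have [E [sE _ EF]] := local_frame (mchart_atP p).
  exists (\row_l F (E l) p) => Z sZ.
  rewrite (EF (fun Z => F Z p)) //; last 2 first.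
  - by move=> ? ? ? ?; exact: FD.
  - by move=> ? ? ? ?; exact: FZ.
  rewrite dotE; apply: eq_bigr => l _.
  by rewrite mxE vec_in_at mulrC.
pose a p := xget 0 [set v | forall Z, smooth_field Z -> F Z p = dot v (Z p)].
have aE Z : smooth_field Z -> forall p, ev a Z p = F Z p.
  move=> sZ p; rewrite ev_at /a; case: xgetP => [v -> /(_ Z sZ) -> //|nH].
  by have [v Hv] := H p; case: (nH v).
have sa : smooth_form a.
  by apply: smooth_form_of_ev => Z sZ; rewrite (_ : ev a Z = F Z);
    [exact: sF|apply/funext => p; exact: aE].
rewrite /form_of; case: xgetP => [b -> [_ //]|nH]; case: (nH a); split => //.
Qed.

Lemma covec_eq0 a p : (forall Z, smooth_field Z -> ev a Z p = 0) -> a p = 0.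
Proof.
move=> a0; have [E [sE Edelta _]] := local_frame (mchart_atP p).
apply/rowP => l; rewrite -dot_delta mxE -(nbhs_singleton Edelta l) vec_in_at.
exact: a0.
Qed.

End Tensors.

Section AffineConnection.
Context {R : realType} {n : nat} {M : manifold R n}.
Variable nabla : (M -> 'rV[R]_n) -> (M -> 'rV[R]_n) -> M -> 'rV[R]_n.
Hypothesis nablaC : affine_connection nabla.
Implicit Types (p q : M) (i j : mchart M) (X Y Z a : M -> 'rV[R]_n) (f g : M -> R).

Lemma fscale1 X : fscale (cst 1) X = X.
Proof. by apply/funext => p; rewrite /fscale scale1r. Qed.

Lemma nablaDr X Y Z : smooth_field X -> smooth_field Y -> smooth_field Z ->
  nabla X (Y + Z) = nabla X Y + nabla X Z.
Proof. by move=> sX sY sZ; have := conn_linr nablaC 1 sX sY sZ; rewrite !scale1r. Qed.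

Lemma nablaDl X Y Z : smooth_field X -> smooth_field Y -> smooth_field Z ->
  nabla (X + Y) Z = nabla X Z + nabla Y Z.
Proof.
move=> sX sY sZ; have := conn_linl nablaC (smooth_fun_cst (M := M) 1) sX sY sZ.
by rewrite !fscale1.
Qed.

Lemma nabla0l Z : smooth_field Z -> nabla 0 Z = 0.
Proof.
move=> sZ; have s0 := @smooth_field0 _ _ M.
by apply: (addIr (nabla 0 Z)); rewrite -nablaDl // !add0r.
Qed.

Lemma nabla_fscale f X Z : smooth_fun f -> smooth_field X -> smooth_field Z ->
  nabla (fscale f X) Z = fscale f (nabla X Z).
Proof.
move=> sf sX sZ; have s0 := @smooth_field0 _ _ M.
by have := conn_linl nablaC sf sX s0 sZ; rewrite nabla0l // !addr0.
Qed.

Lemma dual_connectionE X a : smooth_field X -> smooth_form a ->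
  forall Z, smooth_field Z -> forall p,
    ev (dual_connection nabla X a) Z p = deriv X (ev a Z) p - ev a (nabla X Z) p.
Proof.
move=> sX sa; apply: form_of_spec => [Z sZ|Y Z sY sZ p|f Z sf sZ p].
- apply: smooth_funD; first by apply: smooth_deriv => //; exact: smooth_ev.
  by apply: smooth_funN; apply: smooth_ev => //; exact: conn_smooth.
- rewrite evDr derivDr; [|exact: smooth_ev|exact: smooth_ev].
  by rewrite nablaDr // evDr !fctE opprD addrACA.
- rewrite ev_fscale derivMr //; last exact: smooth_ev.
  rewrite (conn_leibniz nablaC) // evDr !ev_fscale !fctE.
  rewrite mulrBr opprD addrA; congr (_ - _).
  by rewrite addrAC subrr add0r.
Qed.

(** The two equations are those that turn, on the total space, into the derivatives
of l_Z and t along the horizontal lift of X. *)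
Lemma nablaJ_eq0 J X (s : M -> 'rV[R]_n * R^o) p :
  smooth_field X -> smooth_section s ->
  nablaJ J nabla X s p = 0 <->
  (forall Z, smooth_field Z ->
    deriv X (ev (fst \o s) Z) p = ev (fst \o s) (nabla X Z) p) /\
  deriv X (snd \o s) p = - ev (fst \o s) (endo J X) p.
Proof.
move=> sX [sa st]; split=> [[d0 t0]|[d0 t0]].
  split=> [Z sZ|]; last by apply/eqP; rewrite -addr_eq0; apply/eqP.
  apply/eqP; rewrite -subr_eq0 -(dual_connectionE sX sa sZ) ev_at d0.
  by rewrite dot0l.
rewrite /nablaJ t0 addNr (_ : dual_connection _ _ _ p = 0) //.
apply: covec_eq0 => Z sZ.
by rewrite dual_connectionE // d0 // subrr.
Qed.

End AffineConnection.

(** * Coordinates on the total space *)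

Section RowBlocks.
Context {R : realType} {V : normedModType R}.

Lemma Ck_on_row_mx k (U : set V) m1 m2 (f : V -> 'rV[R]_m1) (g : V -> 'rV[R]_m2) :
  open U -> Ck_on k U f -> Ck_on k U g -> Ck_on k U (fun x => row_mx (f x) (g x)).
Proof.
move=> oU cf cg; apply: Ck_on_row => // l; case: (split_ordP l) => l' ->.
  by apply: (Ck_on_eq oU) (Ck_on_coord l' oU cf) => x _; rewrite row_mxEl.
by apply: (Ck_on_eq oU) (Ck_on_coord l' oU cg) => x _; rewrite row_mxEr.
Qed.

Lemma derive_linear (W : normedModType R) (f : {linear V -> W}) x v :
  continuous f -> 'D_v f x = f v.
Proof. by move=> cf; rewrite deriveE ?diff_lin //; exact: linear_differentiable. Qed.

End RowBlocks.

Section BundleCharts.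
Context {R : realType} {n : nat} {M : manifold R n}.
Implicit Types (p q : M) (i j : mchart M) (X Y Z a : M -> 'rV[R]_n) (f g : M -> R).
Implicit Types (e : bundle M) (y w : 'rV[R]_(n + (n + 1))).
Implicit Types s : M -> 'rV[R]_n * R^o.

Definition base_part y : 'rV[R]_n := lsubmx y.
Definition cov_part y : 'rV[R]_n := lsubmx (rsubmx y).
Definition scalar_part y : R := rsubmx (rsubmx y) 0 0.

Lemma bundle_row y :
  y = row_mx (base_part y) (row_mx (cov_part y) (const_mx (scalar_part y))).
Proof.
rewrite -[LHS]hsubmxK -[X in row_mx _ X = _]hsubmxK; congr (row_mx _ (row_mx _ _)).
by apply/rowP => k; rewrite !ord1 [RHS]mxE.
Qed.

Lemma continuous_cov_part : continuous cov_part.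
Proof.
by move=> y; apply: continuous_comp; [exact: continuous_rsubmx|exact: continuous_lsubmx].
Qed.

Lemma derive_base_part y w : 'D_w base_part y = base_part w.
Proof.
exact: (derive_linear (f := lsubmx) _ _ (@continuous_lsubmx _ _ _ _)).
Qed.

Lemma derive_cov_part y w : 'D_w cov_part y = cov_part w.
Proof.
exact: (derive_linear (f := lsubmx \o rsubmx) _ _ continuous_cov_part).
Qed.

Lemma differentiable_base_part y : differentiable base_part y.
Proof. exact: differentiable_lsubmx. Qed.

Lemma differentiable_cov_part y : differentiable cov_part y.
Proof.
exact: (linear_differentiable (f := lsubmx \o rsubmx) _ continuous_cov_part).
Qed.

Lemma Ck_on_base_part k (U : set 'rV[R]_(n + (n + 1))) : Ck_on k U base_part.
Proof. exact: (Ck_on_linear (f := lsubmx) _ _ (@continuous_lsubmx _ _ _ _)). Qed.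

Lemma Ck_on_cov_part k (U : set 'rV[R]_(n + (n + 1))) : Ck_on k U cov_part.
Proof. exact: (Ck_on_linear (f := lsubmx \o rsubmx) _ _ continuous_cov_part). Qed.

Lemma scalar_partE y : scalar_part y = y 0 (rshift n (rshift n 0)).
Proof. by rewrite /scalar_part !mxE. Qed.

Lemma differentiable_scalar_part y : differentiable (scalar_part : _ -> R) y.
Proof.
rewrite (_ : scalar_part = fun y => y 0 (rshift n (rshift n 0))).
  exact: differentiable_coord.
by apply/funext => z; rewrite scalar_partE.
Qed.

Lemma derive_scalar_part y w : 'D_w (scalar_part : _ -> R) y = scalar_part w.
Proof.
rewrite (_ : scalar_part = fun y => y 0 (rshift n (rshift n 0))); last first.
  by apply/funext => z; rewrite scalar_partE.
have := @derive_coord R _ _ id w y (rshift n (rshift n 0)) (@derivable_id _ _ _ _).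
by rewrite derive_id => <-.
Qed.

(** The function l_Z : (xi, t) |-> xi(Z) on the total space, in bundle coordinates. *)
Definition ell i Z y : R := dot (cov_part y) (vec_in i Z (base_part y)).

Lemma bchart_image i :
  bcoord i @` bdom i = base_part @^-1` (mcoord i @` mdom i).
Proof. by have := boverlap i i; rewrite !setIid. Qed.

Lemma base_bcoord i e : base_part (bcoord i e) = mcoord i e.1.
Proof. exact: row_mxKl. Qed.

Lemma ell_ev i e s Z : mdom i e.1 -> section_map s e.1 = e ->
  ell i Z (bcoord i e) = ev (fst \o s) Z e.1.
Proof.
case: e => p xt ip [se]; rewrite /ell base_bcoord (ev_chart _ _ ip) /=.
congr dot; rewrite /covec_in (mcoordK _ _ _ ip) /= se.
by rewrite /cov_part /bcoord row_mxKr row_mxKl.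
Qed.

Lemma scalar_bcoord i e : scalar_part (bcoord i e) = e.2.2.
Proof. by rewrite /scalar_part /bcoord row_mxKr row_mxKr mxE. Qed.

Lemma ell_derive i Z y w : smooth_field Z -> (mcoord i @` mdom i) (base_part y) ->
  'D_w (ell i Z) y = dot (cov_part w) (vec_in i Z (base_part y)) +
    dot (cov_part y) ('D_(base_part w) (vec_in i Z) (base_part y)).
Proof.
move=> sZ [p ip py].
have dZ : differentiable (vec_in i Z) (base_part y).
  by rewrite -py; exact: smooth_field_at.
rewrite derive_dot; last 2 first.
- exact: differentiable_cov_part.
- by apply: differentiable_comp => //; exact: differentiable_base_part.
rewrite derive_cov_part -(derive_base_part y w).
by rewrite (derive_comp w erefl (differentiable_base_part y) dZ).
Qed.

Lemma smooth_on_ell i Z : smooth_field Z ->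
  smooth_on (base_part @^-1` (mcoord i @` mdom i)) (ell i Z).
Proof.
move=> sZ k.
have oU : open (base_part @^-1` (mcoord i @` mdom i)).
  by apply: open_lsubmx; exact: chart_open.
apply: Ck_on_dot => //; first exact: Ck_on_cov_part.
apply: (Ck_on_comp oU (chart_open i) _ _ (sZ i k)) => //.
exact: Ck_on_base_part.
Qed.

Lemma differentiable_ell i Z y : smooth_field Z ->
  (mcoord i @` mdom i) (base_part y) -> differentiable (ell i Z) y.
Proof.
move=> sZ Uy; exact: (smooth_on_differentiable (smooth_on_ell i sZ) Uy).
Qed.

Definition section_rep i s (x : 'rV[R]_n) := bcoord i (section_map s (mparam i x)).

Lemma smooth_section_rep i s : smooth_section s ->
  smooth_on (mcoord i @` mdom i) (section_rep i s).
Proof.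
move=> [sa st] k; have oU := chart_open i.
have ct : Ck_on k (mcoord i @` mdom i)
    (fun x => const_mx (s (mparam i x)).2 : 'rV[R]_1).
  apply: Ck_on_row => // j; apply: (Ck_on_eq oU) (st i k) => x _.
  by rewrite [RHS]mxE.
have ci : Ck_on k (mcoord i @` mdom i) (fun x : 'rV[R]_n => x).
  by apply: (@Ck_on_linear _ _ _ _ _ idfun) => x; exact: cvg_id.
apply: (Ck_on_eq oU) (Ck_on_row_mx oU ci (Ck_on_row_mx oU (sa i k) ct)) => x.
rewrite inE => -[p ip <-].
by rewrite /section_rep /bcoord /section_map /covec_in /= (mcoordK _ _ _ ip).
Qed.

(** A horizontal vector is given in the preferred chart; the chain rule, through the
transition of M on one side and that of the bundle on the other, computes it in
any chart. *)
Lemma section_push i s p v : smooth_section s -> mdom i p ->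
  pushforward (section_map s) p v
    *m jac (M := bundle M) (mchart_at p) i (section_map s p) =
  'D_(v *m jac (mchart_at p) i p) (section_rep i s) (mcoord i p).
Proof.
move=> ss ip; have cp := mchart_atP p; rewrite /pushforward.
change (mchart_at (section_map s p)) with (mchart_at p).
set c := mchart_at p in cp *; set e := section_map s p.
change (mcoord (m := bundle M) c \o section_map s \o mparam c) with (section_rep c s).
have dc : differentiable (section_rep c s) (mcoord c p).
  by apply: (smooth_on_differentiable (smooth_section_rep c ss)); exists p.
have di : differentiable (section_rep i s) (mcoord i p).
  by apply: (smooth_on_differentiable (smooth_section_rep i ss)); exists p.
have dB : differentiable (bcoord i \o bparam c) (bcoord c e).
  exact: (@differentiable_transition _ _ (bundle M) c i e cp ip).
have dt := differentiable_transition cp ip.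
have cE : section_rep c s (mcoord c p) = bcoord c e.
  by rewrite /section_rep (mcoordK _ _ _ cp).
rewrite -(deriveEjacobian _ dc) /jac -(deriveEjacobian _ dB) -(deriveEjacobian _ dt).
rewrite (derive_comp _ cE dc dB).
rewrite (derive_comp _ _ dt di); last by rewrite /= (mcoordK _ _ _ cp).
apply: (@derive_eq_on _ _ _ (mcoord c @` (mdom c `&` mdom i))).
- exact: overlap_open.
- move=> x; rewrite inE => -[q [cq iq] <-].
  rewrite /section_rep /= (mcoordK _ _ _ cq) (mcoordK _ _ _ iq).
  by rewrite (bcoordK (e := section_map s q) (i := c)).
- by rewrite inE; exists p.
Qed.

Lemma pushforward_proj e w : pushforward (@bundle_proj _ _ M) e w = base_part w.
Proof.
rewrite /pushforward; pose c : mchart M := mchart_at (bundle_proj e).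
have ce : mdom c e.1 := mchart_atP (bundle_proj e).
change (mchart_at e) with c; change (mchart_at (bundle_proj e)) with c.
change (mcoord (m := bundle M) c e) with (bcoord c e).
pose U := base_part @^-1` (mcoord c @` mdom c).
have oU : open U by apply: open_lsubmx; exact: chart_open.
have Ue : U (bcoord c e) by rewrite /U /= base_bcoord; exists e.1.
have E : {in U, base_part =1 mcoord c \o (@bundle_proj _ _ M) \o mparam (m := bundle M) c}.
  by move=> y; rewrite inE => -[p cp py] /=; rewrite -[lsubmx y]/(base_part y) -py (mcoordK _ _ _ cp).
rewrite -deriveEjacobian; last first.
  exact: (differentiable_eq_on oU Ue E (differentiable_base_part _)).
by rewrite -(derive_eq_on w oU E) ?inE // derive_base_part.
Qed.

Lemma smooth_map_proj : smooth_map (@bundle_proj _ _ M).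
Proof.
split=> [A oA i|i j].
  change (open (@bcoord _ _ M i @` (@bdom _ _ M i `&` fst @^-1` A))).
  by rewrite bcoord_image; apply/open_lsubmx/oA.
change (smooth_on (@bcoord _ _ M i @` (@bdom _ _ M i `&` fst @^-1` mdom j))
  ((mcoord j \o mparam (m := M) i) \o base_part)).
rewrite bcoord_image => k.
have oA := overlap_open M i j.
apply: (Ck_on_comp (open_lsubmx (m2 := (n + 1)%N) oA) oA _ _ (transition_smooth M i j k)) => //.
exact: Ck_on_base_part.
Qed.

End BundleCharts.

(** * Sections that are horizontal at a point *)

Section Affine.
Context {R : realType} {n : nat}.
Implicit Types (b x v : 'rV[R]_n).

Definition affine_at x0 (c : R) b x : R := c + dot b (x - x0).

Lemma affine_at0 x0 c b : affine_at x0 c b x0 = c.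
Proof. by rewrite /affine_at subrr dot0r addr0. Qed.

Lemma affine_atE x0 c b : affine_at x0 c b = cst (c - dot b x0) + (fun x => dot b x).
Proof.
apply/funext => x; rewrite !fctE /affine_at dotBr.
by rewrite [LHS]addrCA addrC.
Qed.

Lemma Ck_on_dotl k (U : set 'rV[R]_n) b : open U -> Ck_on k U (fun x => dot b x).
Proof.
move=> oU; apply: Ck_on_dot => //; first exact: Ck_on_cst.
by apply: (@Ck_on_linear _ _ _ _ _ idfun) => x; exact: cvg_id.
Qed.

Lemma smooth_on_affine_at (U : set 'rV[R]_n) x0 c b :
  open U -> smooth_on U (affine_at x0 c b).
Proof.
move=> oU k; rewrite affine_atE; apply: Ck_onD => //; first exact: Ck_on_cst.
exact: Ck_on_dotl.
Qed.

Lemma derive_affine_at x0 c b x v : 'D_v (affine_at x0 c b) x = dot b v.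
Proof.
have db : differentiable (fun x : 'rV[R]_n => dot b x) x.
  have sb : smooth_on setT (fun x : 'rV[R]_n => dot b x).
    by move=> k; apply: Ck_on_dotl; exact: openT.
  exact: (smooth_on_differentiable sb).
rewrite affine_atE deriveD; last 2 first.
- exact: derivable_cst.
- exact: diff_derivable.
rewrite derive_cst add0r derive_dot; last 2 first.
- exact: differentiable_cst.
- by apply: (@linear_differentiable _ _ _ idfun) => y; exact: cvg_id.
by rewrite derive_cst dot0l add0r derive_id.
Qed.

End Affine.

Section HorizontalSection.
Context {R : realType} {n : nat} {M : manifold R n}.
Variable J : M -> 'M[R]_n.
Variable nabla : (M -> 'rV[R]_n) -> (M -> 'rV[R]_n) -> M -> 'rV[R]_n.
Hypothesis JC : almost_complex J.
Hypothesis nablaC : affine_connection nabla.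
Implicit Types (p q : M) (i j : mchart M) (X Y Z a : M -> 'rV[R]_n) (f g : M -> R).
Implicit Types (e : bundle M) (y w : 'rV[R]_(n + (n + 1))).

Lemma smooth_endo X : smooth_field X -> smooth_field (endo J X).
Proof.
move=> sX i k; have oU := chart_open i.
pose B x := let p := mparam i x in
  jac i (mchart_at p) p *m J p *m jac (mchart_at p) i p.
apply: (Ck_on_eq oU) (Ck_on_mulmx (B := B) oU (sX i k) _) => [x|l m].
  rewrite inE => -[p ip <-]; have cp := mchart_atP p.
  rewrite /vec_in /B (mcoordK _ _ _ ip) /endo -!mulmxA.
  by rewrite [X in _ *m X](mulmxA (jac _ _ _)) (jac_comp cp ip cp) (jac_id cp) mul1mx.
apply: (Ck_on_eq oU) (Ck_on_coord m oU (ac_smooth JC i (delta_mx 0 l) k)) => x _.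
by rewrite /B /= -!mulmxA -rowE [LHS]mxE.
Qed.

Lemma endoD X Y : endo J (X + Y) = endo J X + endo J Y.
Proof. by apply/funext => p; rewrite /endo !fctE mulmxDl. Qed.

Lemma endo_fscale f X : endo J (fscale f X) = fscale f (endo J X).
Proof. by apply/funext => p; rewrite /endo /fscale scalemxAl. Qed.

(** In the preferred chart of p the section is affine, with the first derivatives
that the vanishing of its covariant derivative along the frame prescribes. The
defect is tensorial in the direction Y and in the argument Z of the form, so its
vanishing for the frame E is enough (used through EF). *)
Lemma horizontal_section p (xi : 'rV[R]_n) (t0 : R) :
  exists s : M -> 'rV[R]_n * R^o, [/\ smooth_section s, s p = (xi, t0) &
    forall Y, smooth_field Y -> nablaJ J nabla Y s p = 0].
Proof.
have cp := mchart_atP p; set c := mchart_at p in cp; pose x0 := mcoord c p.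
have oU := chart_open c.
have [phi [phi1 sext _ scov]] := local_cutoff cp.
have [E [sE Edelta EF]] := local_frame cp.
(* The l-th row of coefficients is dictated by E_k (a (E_l)) = a (nabla_(E_k) E_l). *)
pose alpha x : 'rV[R]_n :=
  \row_l affine_at x0 (xi 0 l) (\row_k dot xi (nabla (E k) (E l) p)) x.
(* Likewise E_k t = - a (J E_k). *)
pose tau := affine_at x0 t0 (\row_k - dot xi (endo J (E k) p)).
have salpha : smooth_on (mcoord c @` mdom c) alpha.
  move=> k; apply: Ck_on_row => // l.
  apply: (Ck_on_eq oU) (smooth_on_affine_at x0 (xi 0 l)
    (\row_k dot xi (nabla (E k) (E l) p)) oU k) => x _.
  by rewrite [RHS]mxE.
pose a : M -> 'rV[R]_n := ext_cov c (fun x => phi x *: alpha x).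
pose t : M -> R := ext_fun c (fun x => phi x * tau x).
have sa : smooth_form a by exact: scov.
have st : smooth_fun t by apply: sext; exact: smooth_on_affine_at.
have aE : \forall x \near x0, forall l, (ev a (E l) \o mparam c) x = alpha x 0 l.
  have H : \forall x \near x0, forall l,
      (ev a (E l) \o mparam c) x = dot (phi x *: alpha x) (vec_in c (E l) x).
    apply: near_chart => // q cq l; rewrite /= (mcoordK _ _ _ cq) (ev_chart _ _ cq).
    by rewrite covec_in_ext.
  apply: filterS3 phi1 Edelta H => x phix Ex Hx l.
  by rewrite Hx Ex phix scale1r dot_delta.
have tE : \forall x \near x0, (t \o mparam c) x = tau x.
  have H : \forall x \near x0, (t \o mparam c) x = phi x * tau x.
    by apply: near_chart => // q cq; rewrite /= (mcoordK _ _ _ cq) /t ext_funE.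
  by apply: filterS2 phi1 H => x phix ->; rewrite phix mul1r.
have Ep k : E k p = delta_mx 0 k by rewrite -vec_in_at (nbhs_singleton Edelta).
have ap : a p = xi.
  apply/rowP => l; rewrite -dot_delta -Ep -ev_at.
  have := nbhs_singleton aE l; rewrite /= (mcoordK _ _ _ cp) => ->.
  by rewrite mxE affine_at0.
have tp : t p = t0.
  have := nbhs_singleton tE; rewrite /= (mcoordK _ _ _ cp) => ->.
  by rewrite /tau affine_at0.
exists (fun q => (a q, t q)); split => //; first by rewrite ap tp.
move=> Y sY; apply/(nablaJ_eq0 nablaC J p sY) => //.
have fstE : fst \o (fun q => (a q, t q)) = a by [].
have sndE : snd \o (fun q => (a q, t q)) = t by [].
rewrite fstE sndE.
have dE f k : smooth_fun f ->
    deriv (E k) f p = 'D_(delta_mx 0 k) (f \o mparam c) x0.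
  by move=> sf; rewrite /deriv Ep.
split=> [Z sZ|]; last first.
  apply/eqP; rewrite -addr_eq0; apply/eqP.
  rewrite (EF (fun Y => deriv Y t p + ev a (endo J Y) p)) //.
  - rewrite big1 // => k _; rewrite dE // (near_eq_derive _ tE) derive_affine_at.
    by rewrite dot_delta [X in _ * (X + _)]mxE ev_at ap addNr mulr0.
  - by move=> Y1 Y2 _ _; rewrite derivDl // endoD evDr addrACA.
  - by move=> f Y1 sf _; rewrite deriv_fscale // endo_fscale ev_fscale mulrDr.
have TE l : deriv Y (ev a (E l)) p - ev a (nabla Y (E l)) p = 0.
  have sl : smooth_fun (ev a (E l)) by exact: smooth_ev.
  rewrite (EF (fun Y => deriv Y (ev a (E l)) p - ev a (nabla Y (E l)) p)) //.
  - rewrite big1 // => k _; rewrite dE //.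
    have Hl : \forall x \near x0, (ev a (E l) \o mparam c) x =
        affine_at x0 (xi 0 l) (\row_k dot xi (nabla (E k) (E l) p)) x.
      by apply: filterS aE => x /(_ l) ->; rewrite mxE.
    rewrite (near_eq_derive _ Hl) derive_affine_at dot_delta.
    rewrite [X in _ * (X - _)]mxE ev_at ap.
    by rewrite subrr mulr0.
  - by move=> Y1 Y2 s1 s2; rewrite derivDl // nablaDl // evDr opprD addrACA.
  - move=> f Y1 sf s1; rewrite deriv_fscale // nabla_fscale // ev_fscale.
    by rewrite mulrBr.
apply/eqP; rewrite -subr_eq0 -(dual_connectionE nablaC sY sa sZ).
rewrite (EF (fun Z => ev (dual_connection nabla Y a) Z p)) //.
- by rewrite big1 // => l _; rewrite dual_connectionE // TE mulr0.
- by move=> Z1 Z2 _ _; rewrite evDr.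
- by move=> f Z1 _ _; rewrite ev_fscale.
Qed.

End HorizontalSection.

(** * Horizontal lifts *)

Lemma derive_blocks (R : realType) (V : normedModType R) m k
    (f : V -> 'rV[R]_m) (g : 'I_k -> V -> R) (h : V -> R) x v :
  derivable f x v -> (forall l, derivable (g l) x v) -> derivable h x v ->
  'D_v (fun x => row_mx (f x) (row_mx (\row_l g l x) (const_mx (h x)))) x =
  row_mx ('D_v f x) (row_mx (\row_l 'D_v (g l) x) (const_mx ('D_v h x)))
  :> 'rV[R]_(m + (k + 1)).
Proof.
move=> df dg dh; set F := fun x => row_mx (f x) _; set D := RHS.
have Fl l : (fun x => F x 0 (lshift _ l)) = (fun x => f x 0 l).
  by apply/funext => z; rewrite /F row_mxEl.
have Fm l : (fun x => F x 0 (rshift _ (lshift _ l))) = g l.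
  by apply/funext => z; rewrite /F row_mxEr row_mxEl mxE.
have Fr l : (fun x => F x 0 (rshift _ (rshift _ l))) = h.
  by apply/funext => z; rewrite /F !row_mxEr mxE.
have dF : derivable F x v.
  apply/derivable_mxP => i j; rewrite ord1.
  case: (split_ordP j) => [l ->|j' ->].
    by rewrite Fl; have /derivable_mxP := df; apply.
  case: (split_ordP j') => [l ->|l ->]; first by rewrite Fm; exact: dg.
  by rewrite Fr; exact: dh.
apply/rowP => j; rewrite derive_coord //.
case: (split_ordP j) => [l ->|j' ->].
  by rewrite Fl -derive_coord // /D row_mxEl.
case: (split_ordP j') => [l ->|l ->].
  by rewrite Fm /D row_mxEr row_mxEl [RHS]mxE.
by rewrite Fr /D !row_mxEr [RHS]mxE.
Qed.

Section HorizontalLift.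
Context {R : realType} {n : nat} {M : manifold R n}.
Variable J : M -> 'M[R]_n.
Variable nabla : (M -> 'rV[R]_n) -> (M -> 'rV[R]_n) -> M -> 'rV[R]_n.
Hypothesis JC : almost_complex J.
Hypothesis nablaC : affine_connection nabla.
Implicit Types (p q : M) (i j : mchart M) (X Y Z a : M -> 'rV[R]_n) (f g : M -> R).
Implicit Types (e : bundle M) (y w : 'rV[R]_(n + (n + 1))).

Local Notation hl := (hlift (nablaJ J nabla)).

Lemma section_push_at (s : M -> 'rV[R]_n * R^o) p v : smooth_section s ->
  pushforward (section_map s) p v =
  'D_v (section_rep (mchart_at p) s) (mcoord (mchart_at p) p).
Proof.
move=> ss; have cp := mchart_atP p; have := section_push v ss cp.
rewrite (_ : jac (M := bundle M) _ _ _ = 1%:M); last first.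
  exact: (@jac_id _ _ (bundle M) (mchart_at p) (section_map s p) cp).
by rewrite mulmx1 (jac_id cp) mulmx1.
Qed.

Lemma derive_section_base i (s : M -> 'rV[R]_n * R^o) p v :
  smooth_section s -> mdom i p ->
  base_part ('D_v (section_rep i s) (mcoord i p)) = v.
Proof.
move=> ss ip.
have di : differentiable (section_rep i s) (mcoord i p).
  by apply: (smooth_on_differentiable (smooth_section_rep i ss)); exists p.
rewrite -(derive_base_part (section_rep i s (mcoord i p))).
rewrite (derive_comp v erefl di (differentiable_base_part _)).
rewrite -[RHS](derive_id (mcoord i p)); apply: near_eq_derive.
apply: (near_chart ip) => q iq.
by rewrite /= /section_rep (mcoordK _ _ _ iq) base_bcoord.
Qed.

(** There is a horizontal vector over X by horizontal_section; the choice made by the definition of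
the horizontal lift then has these properties. *)
Lemma hliftP X e : smooth_field X ->
  horizontal (nablaJ J nabla) e (hl X e) /\
  pushforward (@bundle_proj _ _ M) e (hl X e) = X (bundle_proj e).
Proof.
move=> sX; rewrite /hlift; case: xgetP => [w _ //|nH].
case: e nH => p [xi t0] nH.
have [s [ss sp sD]] := horizontal_section J nablaC p xi t0.
case: (nH (pushforward (section_map s) p (X p))); split.
  by exists s, (X p); split => //=; rewrite /section_map sp.
rewrite pushforward_proj section_push_at //.
by rewrite derive_section_base //; exact: mchart_atP.
Qed.

Definition hlift_in i X y := vec_in (M := bundle M) i (hl X) y.

(** If X^h is the image of X p under a section s that is horizontal at p, then l_Z
restricts along s to the function a(Z), with a the form component of s, and t
to the scalar component; nablaJ_eq0 gives their derivatives. As s does not occur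
in the result, X^h does not depend on a choice. *)
Lemma hlift_in_ell i X y : smooth_field X -> (mcoord i @` mdom i) (base_part y) ->
  [/\ base_part (hlift_in i X y) = vec_in i X (base_part y),
      forall Z, smooth_field Z ->
        'D_(hlift_in i X y) (ell i Z) y = ell i (nabla X Z) y &
      scalar_part (hlift_in i X y) = - ell i (endo J X) y].
Proof.
move=> sX Uy.
have [e ie <-{y Uy}] : (bcoord i @` bdom i) y by rewrite bchart_image.
have [hor proj] := hliftP e sX.
have -> : hlift_in i X (bcoord i e) = hl X e *m jac (M := bundle M) (mchart_at (bundle_proj e)) i e.
  rewrite /hlift_in /vec_in; change (mparam (m := bundle M) i (bcoord i e)) with (bparam i (bcoord i e)).
  by rewrite (bcoordK ie).
case: hor => s [v [ss se sD hw]].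
set p := bundle_proj e in ss se sD hw proj *.
have cp := mchart_atP p; have ip : mdom i p := ie.
have vE : v = X p.
  by rewrite -proj hw pushforward_proj section_push_at // derive_section_base.
rewrite hw vE -[X in jac _ _ X]se section_push //.
have XE : X p *m jac (mchart_at p) i p = vec_in i X (mcoord i p).
  by rewrite (vec_in_change _ cp ip) vec_in_at.
rewrite XE base_bcoord -/p; set x := mcoord i p.
have di : differentiable (section_rep i s) x.
  by apply: (smooth_on_differentiable (smooth_section_rep i ss)); exists p.
have repE : section_rep i s x = bcoord i e.
  by rewrite /section_rep /x (mcoordK _ _ _ ip) se.
have [sa st] := ss.
have /(nablaJ_eq0 nablaC J p sX ss)[dZ dt] := sD X sX.
split.
- exact: derive_section_base.
- move=> Z sZ.
  have de : differentiable (ell i Z) (bcoord i e).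
    by apply: (differentiable_ell sZ); rewrite base_bcoord; exists p.
  rewrite (derive_comp _ repE di de) (ell_ev _ ie se) -(dZ Z sZ).
  rewrite (deriv_chart _ _ ip); last exact: smooth_ev.
  apply: near_eq_derive; apply: (near_chart ip) => q iq.
  rewrite /= /section_rep (mcoordK _ _ _ iq).
  exact: (ell_ev (e := section_map s q)).
- rewrite -(derive_scalar_part (bcoord i e)).
  rewrite (derive_comp _ repE di (differentiable_scalar_part _)).
  rewrite (ell_ev _ ie se) -dt (deriv_chart _ st ip).
  apply: near_eq_derive; apply: (near_chart ip) => q iq.
  by rewrite /= /section_rep (mcoordK _ _ _ iq) scalar_bcoord.
Qed.

(** Constant components on a neighbourhood, not just at a point: derivatives of the
components vanish on P. *)
Definition coordinate_frame i (P : set 'rV[R]_n) (E : 'I_n -> M -> 'rV[R]_n) :=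
  [/\ open P, P `<=` mcoord i @` mdom i, forall l, smooth_field (E l) &
      forall x, P x -> forall l, vec_in i (E l) x = delta_mx 0 l].

Lemma coordinate_frame_exists i p : mdom i p ->
  exists P E, coordinate_frame i P E /\ P (mcoord i p).
Proof.
move=> ip; have [E [sE Edelta _]] := local_frame ip.
have [P [oP Pp PE]] := near_open Edelta.
exists (P `&` mcoord i @` mdom i), E; split; last by split => //; exists p.
split; [exact: openI (chart_open i)|by move=> x []|exact: sE|].
by move=> x [Px _]; exact: PE.
Qed.

(** The coordinate expression of X^h. Since E_l has constant components, the middle
entries are the contractions of X and xi with the Christoffel symbols. *)
Definition hlift_form i (E : 'I_n -> M -> 'rV[R]_n) X y : 'rV[R]_(n + (n + 1)) :=
  row_mx (vec_in i X (base_part y))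
    (row_mx (\row_l ell i (nabla X (E l)) y) (const_mx (- ell i (endo J X) y))).

(** For a coordinate frame, l_(E_l) is the l-th fibre coordinate, so that its
derivative along X^h is a component of X^h. *)
Lemma hlift_in_form i P E X y : coordinate_frame i P E -> smooth_field X ->
  P (base_part y) -> hlift_in i X y = hlift_form i E X y.
Proof.
move=> [oP PU sE PE] sX Py; have Uy := PU _ Py.
have [bE ellE fE] := hlift_in_ell sX Uy.
rewrite [LHS]bundle_row bE fE /hlift_form; congr (row_mx _ (row_mx _ _)).
apply/rowP => l; rewrite [RHS]mxE -ellE // ell_derive // PE // dot_delta.
rewrite (_ : 'D_(base_part _) _ _ = 0) ?dot0r ?addr0 //.
rewrite -[RHS](derive_cst (delta_mx 0 l : 'rV[R]_n) (base_part y) (base_part (hlift_in i X y))).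
apply: near_eq_derive.
have := open_nbhs_nbhs (conj oP Py); apply: filterS => x Px; exact: PE.
Qed.

Lemma smooth_hlift X : smooth_field X -> smooth_field (hl X).
Proof.
move=> sX.
change (forall i : mchart M, smooth_on (bcoord i @` bdom i) (hlift_in i X)) => i.
rewrite bchart_image; apply: smooth_on_near => y [p ip py].
have [P [E [frE Pp]]] := coordinate_frame_exists ip.
have [oP PU sE PE] := frE.
have oU : open (base_part @^-1` P) by exact: open_lsubmx.
exists (base_part @^-1` P), (hlift_form i E X); split => //.
- by rewrite /= -py.
- have sell Z k : smooth_field Z -> Ck_on k (base_part @^-1` P) (ell i Z).
    by move=> sZ; apply: Ck_on_sub (smooth_on_ell i sZ k) => z /PU.
  move=> k; apply: Ck_on_row_mx => //.
    apply: (Ck_on_comp oU oP _ _ (Ck_on_sub PU (sX i k))) => //.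
    exact: Ck_on_base_part.
  apply: Ck_on_row_mx => //; apply: Ck_on_row => // l.
    have := sell _ k (conn_smooth nablaC sX (sE l)).
    by apply: Ck_on_eq => // z _; rewrite [RHS]mxE.
  have := Ck_onN oU (sell _ k (smooth_endo JC sX)).
  by apply: Ck_on_eq => // z _; rewrite [RHS]mxE.
- by move=> z; rewrite inE => Pz; exact: (hlift_in_form frE).
Qed.

Lemma hlift_at X e : hl X e = hlift_in (mchart_at (bundle_proj e)) X (bcoord (mchart_at (bundle_proj e)) e).
Proof. by rewrite -[LHS](@vec_in_at _ _ (bundle M)). Qed.

Lemma ellD i Y Z y : ell i (Y + Z) y = ell i Y y + ell i Z y.
Proof. by rewrite /ell vec_inD dotDr. Qed.

Lemma ellB i Y Z y : ell i (Y - Z) y = ell i Y y - ell i Z y.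
Proof. by rewrite /ell vec_inB dotBr. Qed.

Lemma ell_fscale i f Z y : ell i (fscale f Z) y = f (mparam i (base_part y)) * ell i Z y.
Proof. by rewrite /ell vec_in_fscale dotZr. Qed.

(** Every component of hlift_form is C^oo(M)-linear in X. *)
Lemma hlift_fscaleD f X Y : smooth_fun f -> smooth_field X -> smooth_field Y ->
  hl (fscale f X + Y) = fscale (f \o @bundle_proj _ _ M) (hl X) + hl Y.
Proof.
move=> sf sX sY; apply/funext => e.
have sfX := smooth_field_fscale sf sX; have sfXY := smooth_fieldD sfX sY.
change (hl (fscale f X + Y) e = f (bundle_proj e) *: hl X e + hl Y e).
rewrite !hlift_at; set c := mchart_at _; set y := bcoord c e.
have cp : mdom c (bundle_proj e) := mchart_atP (bundle_proj e).
have [P [E [frE Pp]]] := coordinate_frame_exists cp.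
have Py : P (base_part y) by rewrite base_bcoord.
rewrite !(hlift_in_form frE) // /hlift_form.
have fE : f (mparam c (base_part y)) = f (bundle_proj e).
  by rewrite base_bcoord (mcoordK _ _ _ cp).
have [_ _ sE _] := frE.
rewrite !scale_row_mx !add_row_mx vec_inD vec_in_fscale fE; congr (row_mx _ (row_mx _ _)).
  apply/rowP => l; rewrite !mxE nablaDl // nabla_fscale // ellD ell_fscale.
  by rewrite fE.
apply/rowP => l; rewrite !mxE endoD endo_fscale ellD ell_fscale fE.
by rewrite opprD mulrN.
Qed.

End HorizontalLift.

(** * The bracket of horizontal lifts *)

Section Bracket.
Context {R : realType} {n : nat} {M : manifold R n}.
Variable J : M -> 'M[R]_n.
Variable nabla : (M -> 'rV[R]_n) -> (M -> 'rV[R]_n) -> M -> 'rV[R]_n.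
Hypothesis JC : almost_complex J.
Hypothesis nablaC : affine_connection nabla.
Hypothesis nablaT : torsion_free nabla.
Hypothesis nablaF : flat nabla.
Hypothesis nablaJ0 : forall X Y, smooth_field X -> smooth_field Y ->
  d_nabla nabla J X Y = 0.
Implicit Types (p q : M) (i j : mchart M) (X Y Z a : M -> 'rV[R]_n) (f g : M -> R).
Implicit Types (e : bundle M) (y w : 'rV[R]_(n + (n + 1))).

Local Notation hl := (hlift (nablaJ J nabla)).
Local Notation hlift_in := (hlift_in J nabla).

Lemma derive_hlift_in i P E X y w : coordinate_frame i P E -> smooth_field X ->
  P (base_part y) ->
  'D_w (hlift_in i X) y =
  row_mx ('D_(base_part w) (vec_in i X) (base_part y))
    (row_mx (\row_l 'D_w (ell i (nabla X (E l))) y)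
      (const_mx (- 'D_w (ell i (endo J X)) y))).
Proof.
move=> frE sX Py; have [oP PU sE PE] := frE; have Uy := PU _ Py.
have dell Z : smooth_field Z -> derivable (ell i Z) y w.
  by move=> sZ; apply: diff_derivable; exact: differentiable_ell.
have dX : differentiable (vec_in i X) (base_part y).
  exact: smooth_on_differentiable (sX i) Uy.
have dXb : differentiable (vec_in i X \o base_part) y.
  by apply: differentiable_comp => //; exact: differentiable_base_part.
have sJX := smooth_endo JC sX.
have sEl l := conn_smooth nablaC sX (sE l).
rewrite (@near_eq_derive _ _ _ _ (hlift_form J nabla i E X)); last first.
  have oU : open (base_part @^-1` P : set 'rV[R]_(n + (n + 1))) by exact: open_lsubmx.
  have := open_nbhs_nbhs (conj oU (Py : (base_part @^-1` P) y)).
  by apply: filterS => z Pz; exact: (hlift_in_form J nablaC frE).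
rewrite /hlift_form (derive_blocks (f := vec_in i X \o base_part)); first last.
- by apply: derivableN; exact: dell.
- by move=> l; exact: dell.
- exact: diff_derivable.
rewrite -(derive_base_part y w).
rewrite (derive_comp w erefl (differentiable_base_part y) dX).
by rewrite [X in const_mx X](deriveN (dell _ sJX)).
Qed.

(** Without torsion the bracket is a difference of covariant derivatives, whose
smoothness is part of the definition of a connection. *)
Lemma smooth_lie X Y : smooth_field X -> smooth_field Y -> smooth_field (lie X Y).
Proof.
move=> sX sY; rewrite -(nablaT sX sY).
by apply: smooth_fieldB; exact: conn_smooth.
Qed.

(** Differentiating the components of Y^h along X^h uses hlift_in_ell for the fields
nabla_Y E_l and J Y: the middle components of the bracket become l of the
commutator of nabla_X and nabla_Y on E_l, and the last one minus l of
nabla_X (J Y) - nabla_Y (J X). *)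
Lemma hlift_lie X Y : smooth_field X -> smooth_field Y ->
  lie (hl X) (hl Y) = hl (lie X Y).
Proof.
move=> sX sY; apply/funext => e; have sXY := smooth_lie sX sY.
pose c : mchart M := mchart_at (bundle_proj e); pose y := bcoord c e.
change ('D_(hl X e) (hlift_in c Y) y - 'D_(hl Y e) (hlift_in c X) y = hl (lie X Y) e).
rewrite !hlift_at -/c -/y.
have cp : mdom c (bundle_proj e) := mchart_atP (bundle_proj e).
have [P [E [frE Pp]]] := coordinate_frame_exists cp.
have yE : base_part y = mcoord c (bundle_proj e) by exact: base_bcoord.
have Py : P (base_part y) by rewrite yE.
have [_ PU sE _] := frE; have Uy := PU _ Py.
rewrite !(derive_hlift_in _ frE) // [RHS](hlift_in_form J nablaC frE) // /hlift_form.
have [bX eX _] := hlift_in_ell J nablaC sX Uy.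
have [bY eY _] := hlift_in_ell J nablaC sY Uy.
have sJX := smooth_endo JC sX; have sJY := smooth_endo JC sY.
have sXE l := conn_smooth nablaC sX (sE l).
have sYE l := conn_smooth nablaC sY (sE l).
rewrite bX bY !opp_row_mx !add_row_mx; congr (row_mx _ (row_mx _ _)).
- by rewrite yE !vec_in_at.
- apply/rowP => l; rewrite !mxE eX // eY // -ellB; congr (ell c _ y).
  by apply/eqP; rewrite -subr_eq0; apply/eqP; exact: nablaF.
- apply/rowP => l; rewrite !mxE eX // eY // -opprD -ellB; congr (- ell c _ y).
  by apply/eqP; rewrite -subr_eq0; apply/eqP; exact: nablaJ0.
Qed.

End Bracket.

Theorem corollary4p24 (R : realType) (n : nat) (M : manifold R n)
    (J : M -> 'M[R]_n)
    (nabla : (M -> 'rV[R]_n) -> (M -> 'rV[R]_n) -> M -> 'rV[R]_n) :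
  special_complex_structure J nabla ->
  courant_action (E := Bn_courant M) (M' := bundle M) bundle_proj
    (fun s => hlift (nablaJ J nabla) (vec_part s)).
Proof.
move=> [JC nablaC nablaT nablaF nablaJ0].
have s0 := @smooth_field0 _ _ M.
split.
- exact: smooth_map_proj.
- by move=> s [sX _ _]; exact: smooth_hlift.
- move=> k s t [sX _ _] [sY _ _].
  exact: (hlift_fscaleD J nablaC (smooth_fun_cst k) sX sY).
- by move=> s [sX _ _] e; have [_] := hliftP J nablaC e sX.
- move=> f s sf [sX _ _].
  have h0 : hlift (nablaJ J nabla) 0 = 0.
    have := hlift_fscaleD J nablaC (smooth_fun_cst 1) s0 s0.
    rewrite fscale1 fscale1 addr0 => H.
    by apply: (addIr (hlift (nablaJ J nabla) 0)); rewrite -H add0r.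
  by have := hlift_fscaleD J nablaC sf sX s0; rewrite h0 !addr0.
- by move=> s t [sX _ _] [sY _ _]; exact: hlift_lie.
Qed.
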